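(* Let $\mathcal H$ and $\hat{\mathcal H}$ be compact self-adjoint operators with non-negative eigenvalues on a separable real Hilbert space $\mathbb H$, and let $J$ be a finite index set with spectral gap $\gamma_J>0$ (all notation as defined in the context). Then $$\big\|\hat{\mathcal P}_J-\mathcal P_J-\hat{\mathcal S}_J\big\|_{\mathrm{op}}\le\Big(8\min\Big\{D,\;1+\frac{2\theta_{\max}-2\theta_{\min}}{\pi\gamma_J}\Big\}+32\Big)\hat\alpha_J^2 .$$ Moreover, if $\hat\alpha_J\le 1/4$, then $$\big\|\hat{\mathcal P}_J-\mathcal P_J-\hat{\mathcal S}_J\big\|_{\mathrm{HS}}\le\Big(\frac{112\sqrt D}{9}+16\Big)\hat\alpha_J\hat\beta_J .$$
   Context: $\mathbb H$ is a separable real Hilbert space with inner product $\langle\cdot,\cdot\rangle$; $\|\cdot\|_{\mathrm{op}}$ and $\|\cdot\|_{\mathrm{HS}}$ are the operator and Hilbert–Schmidt norms; $(u\otimes v)w=\langle v,w\rangle u$. $\mathcal H,\hat{\mathcal H}$ are compact self-adjoint operators on $\mathbb H$ whose eigenvalues are all non-negative. Write $\mathcal H=\sum_{k}\lambda_k\mathcal Q_k$, $\mathcal Q_k=\psi_k\otimes\psi_k$, with $\lambda_1\ge\lambda_2\ge\dots\ge0$ (repeated according to multiplicity) and orthonormal eigenvectors $\psi_k$; similarly $\hat{\mathcal H}=\sum_k\hat\lambda_k\hat{\mathcal Q}_k$, $\hat{\mathcal Q}_k=\hat\psi_k\otimes\hat\psi_k$, $\hat\lambda_1\ge\hat\lambda_2\ge\dots\ge0$.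 Both eigenvector systems are understood to be complete, $\sum_k\mathcal Q_k=\sum_k\hat{\mathcal Q}_k=$ identity: if the ordered sequence misses part of the kernel, an orthonormal basis of the remaining part of the kernel is adjoined with eigenvalue $0$, and is included in all sums over indices not in $J$. $J\subset\mathbb N$ is a finite nonempty index set with $\gamma_J:=\min_{k\in J,\ell\notin J}|\lambda_k-\lambda_\ell|>0$. The distinct values among $\{\lambda_k\}_{k\in J}$ are $\theta_{\max}=\theta_1>\dots>\theta_D=\theta_{\min}$ ($D$ is their number). $\mathcal P_J=\sum_{k\in J}\mathcal Q_k$, $\hat{\mathcal P}_J=\sum_{k\in J}\hat{\mathcal Q}_k$, and $$\hat{\mathcal S}_J=\sum_{k\in J}\sum_{\ell\notin J}\frac{\mathcal Q_k(\hat{\mathcal H}-\mathcal H)\mathcal Q_\ell+\mathcal Q_\ell(\hat{\mathcal H}-\mathcal H)\mathcal Q_k}{\lambda_k-\lambda_\ell}.$$ Weighted perturbation quantities: with $$|\mathcal R|_J^{1/2}=\sum_{k\notin J}\frac{\mathcal Q_k}{\sqrt{\min_{m\in J}|\lambda_k-\lambda_m|}},\qquad \mathcal T_J^{1/2}=\frac{1}{\sqrt{\gamma_J}}\mathcal P_J+|\mathcal R|_J^{1/2},$$ set $\hat\alpha_J=\|\mathcal T_J^{1/2}(\hat{\mathcal H}-\mathcal H)\mathcal T_J^{1/2}\|_{\mathrm{op}}$ and $\hat\beta_J=\gamma_J^{-1/2}\||\mathcal R|_J^{1/2}(\hat{\mathcal H}-\mathcal H)\mathcal P_J\|_{\mathrm{HS}}$.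 *)

(* Defs.v *)
From HB Require Import structures.
From mathcomp Require Import all_boot all_order all_algebra.
From mathcomp Require Import finmap sesquilinear.
From mathcomp Require Import all_classical all_reals all_analysis.
From mathcomp Require summability.
Set Implicit Arguments.
Unset Strict Implicit.
Unset Printing Implicit Defensive.
Import Order.TTheory GRing.Theory Num.Theory.
Import numFieldNormedType.Exports.
Local Open Scope classical_set_scope.
Local Open Scope ring_scope.

Section hilbert.
Context {R : realType} {V : completeNormedModType R}.
Implicit Types (ip : {dot V for @idfun R}) (A B : V -> V) (x y : V).

Definition separable_space (T : topologicalType) :=
  exists2 S : set T, countable S & dense S.

(* V is a Hilbert space for ip when its complete norm is induced by ip *)
Definition norm_induced_by ip := forall x, ip x x = `|x| ^+ 2.

Definition compact_operator A :=
  forall S : set V, bounded_set S -> precompact (A @` S).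

Definition self_adjoint ip A := forall x y, ip (A x) y = ip x (A y).

Definition nonneg_eigenvalues A :=
  forall (mu : R) x, x != 0 -> A x = mu *: x -> 0 <= mu.

Definition tensor ip (u v : V) : V -> V := fun w => ip v w *: u.

(* Unordered sum of (f i) over i in D: the limit of the finite partial sums
   along the directed set of finite sets of indices. *)
Definition series_over (I : choiceType) (D : set I) (f : I -> V) : V :=
  summability.sum (patch (fun=> 0) D f).

Definition orthonormal_basis ip (I : choiceType) (D : set I) (e : I -> V) :=
  [/\ forall i, D i -> ip (e i) (e i) = 1,
      forall i j, D i -> D j -> i <> j -> ip (e i) (e j) = 0 &
      forall x,
        summability.partial_sum
          (patch (fun=> 0) D (fun i => tensor ip (e i) (e i) x))
          @ summability.totally --> x].

(* Both norms take extended real values, so they are meaningful (and possibly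
   +oo) for every linear map, without a boundedness assumption. *)
Definition op_norm A : \bar R :=
  ereal_sup [set (`|A x|)%:E | x in [set x | `|x| <= 1]].

(* The value does not depend on the chosen orthonormal basis b, a set of
   vectors indexed by itself. *)
Definition hs_norm ip A : \bar R :=
  let b := get [set b : set V | orthonormal_basis ip b id] in
  sqrte (\esum_(e in b) (`|A e| ^+ 2)%:E).

End hilbert.

(* Indices of a complete system of eigenvectors: [inl k] is the k-th position
   (from 0) of the ordered sequence of eigenvalues, [inr j] indexes the kernel
   vectors adjoined to it.  [eigidx] is the set of indices really in use, so
   that finite-dimensional spaces and empty adjoined parts are covered;
   [eigval] and [eigvec] are meaningful on [eigidx] only. *)
Record eigensystem (R : realType) (V : completeNormedModType R) := EigenSystem {
  eigidx : set (nat + nat) ;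
  eigval : nat + nat -> R ;
  eigvec : nat + nat -> V }.

Section perturbation.
Context {R : realType} {V : completeNormedModType R}.
Variable ip : {dot V for @idfun R}.
Implicit Types (s : eigensystem V) (J : {fset nat}) (A E : V -> V).

Definition is_eigensystem A s :=
  [/\ orthonormal_basis ip (eigidx s) (eigvec s),
      forall i, eigidx s i -> A (eigvec s i) = eigval s i *: eigvec s i,
      forall k l : nat, (k <= l)%N -> eigidx s (inl l) ->
        eigidx s (inl k) /\ eigval s (inl l) <= eigval s (inl k),
      forall i, eigidx s i -> 0 <= eigval s i &
      forall j, eigidx s (inr j) -> eigval s (inr j) = 0].

Definition Qproj s (i : nat + nat) : V -> V := tensor ip (eigvec s i) (eigvec s i).

Definition off s J : set (nat + nat) := eigidx s `\` [set inl k | k in [set` J]].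

(* For a compact operator the infimum is attained as soon as it is positive.
   The convention inf set0 = 0 gives gap 0 when J exhausts all the indices. *)
Definition gap s J : R :=
  inf [set `|eigval s (inl k) - eigval s l| | k in [set` J] & l in off s J].

(* J is finite and nonempty, so inf and sup over J are minimum and maximum. *)
Definition dist_to s J (mu : R) : R :=
  inf [set `|mu - eigval s (inl m)| | m in [set` J]].

Definition theta_max s J : R := sup [set eigval s (inl k) | k in [set` J]].
Definition theta_min s J : R := inf [set eigval s (inl k) | k in [set` J]].

Definition nb_values s J : nat := #|` [fset eigval s (inl k) | k in J]%fset|.

Definition PJ s J : V -> V := fun x => \sum_(k <- J) Qproj s (inl k) x.

Definition SJ s J E : V -> V := fun x =>
  \sum_(k <- J) series_over (off s J) (fun l =>
    (eigval s (inl k) - eigval s l)^-1 *: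
      (Qproj s (inl k) (E (Qproj s l x)) + Qproj s l (E (Qproj s (inl k) x)))).

Definition absR_half s J : V -> V := fun x =>
  series_over (off s J) (fun l =>
    (Num.sqrt (dist_to s J (eigval s l)))^-1 *: Qproj s l x).

Definition T_half s J : V -> V := fun x =>
  (Num.sqrt (gap s J))^-1 *: PJ s J x + absR_half s J x.

Definition alphaJ s J E : \bar R := op_norm (T_half s J \o E \o T_half s J).

Definition betaJ s J E : \bar R :=
  ((Num.sqrt (gap s J))^-1%:E * hs_norm ip (absR_half s J \o E \o PJ s J))%E.

End perturbation.

(* Main.v *)
Require Import Defs.
From mathcomp Require Import all_boot all_order all_algebra.
From mathcomp Require Import finmap sesquilinear.
From mathcomp Require Import all_classical all_reals all_analysis.
From mathcomp Require summability.
From mathcomp Require Import ring lra.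
Set Implicit Arguments.
Unset Strict Implicit.
Unset Printing Implicit Defensive.
Import Order.TTheory GRing.Theory Num.Theory.
Import numFieldNormedType.Exports.
Local Open Scope classical_set_scope.
Local Open Scope ring_scope.

(** Let [E = Hhat - H] and let [Tinv] be the inverse of [T_half].  The weighted
    perturbation [A = T_half E T_half] has norm [a = alphaJ], and every estimate
    uses [E] through the factorization [E = Tinv A Tinv].

    The remainder [Phat - P - S] is studied through its blocks along [P] and
    [Q = 1 - P].  The diagonal blocks [- P Qhat P] and [Q Phat Q] are quadratic
    in the defect [Q Phat], because two projections of the same finite rank have
    defects [Q Phat] and [Qhat P] of the same size ([rank_swap]).  In the
    off-diagonal block [X = Q (Phat - P - S) P] the first order cancels, and what
    is left solves the Sylvester equation
    [H X - X H = Q (E Qhat + Phat E) P] ([remainder_sylvester]), whose right-hand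
    side is of second order.

    The constants in the solution of such an equation must not see the number of
    eigenvalues.  For this purpose the eigenvalues in [J] are sorted into
    [m] intervals of length less than [pi * gap / 2], with
    [m <= min (D, 1 + (2 theta_max - 2 theta_min) / (pi * gap))].  Let [c] be the
    centre of such an interval and [r <= gap] its half-length: [H - c] is at most
    [r] on the eigenvectors of the interval and at least [r + dist] outside [J],
    so that inverting it outside [J] turns the equation into a contraction
    ([block_sylvester]).  Pieces attached to different intervals are orthogonal
    and add up at the price of a factor [sqrt m] ([bucket_bound]); quadratic
    terms thus receive a factor [m].

    The same contraction, applied to the eigenvectors of [Hhat], bounds [Q Phat]
    and its weighted version [Tinv Q Phat] ([block_Q_bound],
    [block_TinvQ_le]).  It needs to know where the eigenvalues of [Hhat] with
    index in [J] are: by the min-max principle they have moved by at most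
    [a * gap] ([eigval_perturbation]).  For large [a] the norms of [Phat - P] and
    of [S] suffice ([remainder_norm_crude]).

    For the Hilbert-Schmidt norm the resolvents act on one eigenvector at a time,
    so the intervals enter only through the operator norm of [Q Phat]; products
    with a bounded factor on the right are reduced to products on the left by
    taking adjoints ([sq_hs_adjoint]). *)

(** * Inner products and pointwise operator bounds *)

Section InnerProduct.
Context {R : realType} {V : completeNormedModType R}.
Variable ip : {dot V for @idfun R}.
Hypothesis ipN : norm_induced_by ip.

Lemma ipC x y : ip x y = ip y x.
Proof. by rewrite hermC expr0 mul1r. Qed.

Lemma ipDr x y z : ip x (y + z) = ip x y + ip x z.
Proof. exact: linearDr. Qed.

Lemma ipNr x y : ip x (- y) = - ip x y.
Proof. exact: linearNr. Qed.

Lemma ipBr x y z : ip x (y - z) = ip x y - ip x z.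
Proof. exact: linearBr. Qed.

Lemma ipZr (a : R) x y : ip x (a *: y) = a * ip x y.
Proof. exact: linearZr_LR. Qed.

Lemma ip0r x : ip x 0 = 0.
Proof. exact: linear0r. Qed.

Lemma ip_sumr (I : Type) (r : seq I) (P : pred I) x (F : I -> V) :
  ip x (\sum_(i <- r | P i) F i) = \sum_(i <- r | P i) ip x (F i).
Proof. exact: linear_sumr. Qed.

Lemma ipDl x y z : ip (y + z) x = ip y x + ip z x.
Proof. by rewrite ipC ipDr !(ipC x). Qed.

Lemma ipNl x y : ip (- y) x = - ip y x.
Proof. by rewrite ipC ipNr (ipC x). Qed.

Lemma ipBl x y z : ip (y - z) x = ip y x - ip z x.
Proof. by rewrite ipDl ipNl. Qed.

Lemma ipZl (a : R) x y : ip (a *: y) x = a * ip y x.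
Proof. by rewrite ipC ipZr (ipC x). Qed.

Lemma ip0l x : ip 0 x = 0.
Proof. by rewrite ipC ip0r. Qed.

Lemma ip_suml (I : Type) (r : seq I) (P : pred I) x (F : I -> V) :
  ip (\sum_(i <- r | P i) F i) x = \sum_(i <- r | P i) ip (F i) x.
Proof. by rewrite ipC ip_sumr; apply: eq_bigr => i _; rewrite ipC. Qed.

Lemma cauchy_schwarz x y : ip x y <= `|x| * `|y|.
Proof.
have [->|x0] := eqVneq x 0; first by rewrite ip0l normr0 mul0r.
have [->|y0] := eqVneq y 0; first by rewrite ip0r normr0 mulr0.
have := sqr_ge0 `| `|y| *: x - `|x| *: y|; rewrite -ipN.
rewrite ipBl !ipBr !ipZl !ipZr !ipN (ipC y x).
have : 0 < `|x| by rewrite normr_gt0.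
have : 0 < `|y| by rewrite normr_gt0.
move: `|x| `|y| (ip x y) => a b c a0 b0.
have -> : b * (b * a ^+ 2) - b * (a * c) - (a * (b * c) - a * (a * b ^+ 2)) =
  (2 * a * b) * (a * b - c) by ring.
by rewrite pmulr_rge0 ?subr_ge0 // !mulr_gt0.

Qed.

Lemma cauchy_schwarz_norm x y : `|ip x y| <= `|x| * `|y|.
Proof.
rewrite ler_norml cauchy_schwarz andbT lerNl -ipNl.
by rewrite (le_trans (cauchy_schwarz _ _)) // normrN.
Qed.

Lemma pythagoras x y : ip x y = 0 -> `|x + y| ^+ 2 = `|x| ^+ 2 + `|y| ^+ 2.
Proof. by move=> xy; rewrite -!ipN ipDl !ipDr (ipC y x) xy addr0 add0r. Qed.

Lemma cvg_ipr (T : Type) (F : set_system T) {FF : Filter F} (f : T -> V) l v :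
  f @ F --> l -> (fun t => ip v (f t)) @ F --> ip v l.
Proof.
move=> /cvgrPdist_le fl; apply/cvgrPdist_le => e e0.
have v0 : 0 < `|v| + 1 by rewrite ltr_wpDl.
near=> t.
rewrite -ipBr (le_trans (cauchy_schwarz_norm _ _)) //.
rewrite (@le_trans _ _ ((`|v| + 1) * `|l - f t|)) ?ler_wpM2r ?lerDl //.
rewrite mulrC -ler_pdivlMr //.
near: t; apply: fl; exact: divr_gt0.
Unshelve. all: by end_near. Qed.

End InnerProduct.

(** Operators are compared through pointwise bounds, so that only vectors and
    scalars ever appear in estimates. *)
Definition opbound {R : realType} {V : completeNormedModType R}
  (A : V -> V) (C : R) := forall x, `|A x| <= C * `|x|.

Definition adjoint_pair {R : realType} {V : completeNormedModType R}
  (ip : {dot V for @idfun R}) (A B : V -> V) :=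
  forall x y, ip (A x) y = ip x (B y).

Lemma opbound_adj {R : realType} {V : completeNormedModType R}
  (ip : {dot V for @idfun R}) (ipN : norm_induced_by ip) (A B : V -> V) C :
  adjoint_pair ip A B -> opbound A C -> opbound B C.
Proof.
move=> AB AC x.
have [->|Bx0] := eqVneq `|B x| 0.
  by have [->|x0] := eqVneq x 0; [rewrite normr0 mulr0|
     have := AC x; have := normr_ge0 (A x); move=> h1 h2; apply: le_trans h2].
have Bp : 0 < `|B x| by rewrite lt_neqAle eq_sym Bx0 normr_ge0.
rewrite -(ler_pM2r Bp) -expr2 -ipN -AB.
rewrite (le_trans (cauchy_schwarz ipN _ _)) // mulrAC ler_wpM2r //.
Qed.

(** * Orthonormal bases and diagonal operators *)

Lemma ler_limit (R : realType) (T : Type) (F : set_system T)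
  (FF : ProperFilter F) (f g : T -> R) (a b : R) :
  f @ F --> a -> g @ F --> b -> (forall t, f t <= g t) -> a <= b.
Proof.
move=> /cvgrPdist_lt fa /cvgrPdist_lt gb fg; rewrite leNgt; apply/negP => ba.
have e0 : 0 < (a - b) / 2 by rewrite divr_gt0 // subr_gt0.
have [t []] := filter_ex (filterI (fa _ e0) (gb _ e0)).
rewrite !ltr_distlC => /andP[h1 _] /andP[_ h2].
by have := fg t; lra.
Qed.

Section OrthonormalBasis.
Context {R : realType} {V : completeNormedModType R}.
Variable ip : {dot V for @idfun R}.
Hypothesis ipN : norm_induced_by ip.
Variables (I : choiceType) (D : set I) (e : I -> V).
Hypothesis ob : orthonormal_basis ip D e.

Let tot := @summability.totally I.
Let totF : ProperFilter tot := @summability.totally_filter I.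
Let totFilter : Filter tot := @filter_filter _ _ totF.
#[local] Existing Instance totF.
#[local] Existing Instance totFilter.

Definition diag_sum (f : I -> R) (x : V) : {fset I} -> V :=
  summability.partial_sum
    (patch (fun=> 0) D (fun i => f i *: tensor ip (e i) (e i) x)).

Definition diagop (f : I -> R) (x : V) : V :=
  series_over D (fun i => f i *: tensor ip (e i) (e i) x).

Lemma diag_sumE f x F :
  diag_sum f x F = \sum_(i <- F | i \in D) (f i * ip (e i) x) *: e i.
Proof.
rewrite /diag_sum /summability.partial_sum.
rewrite -(big_seq_fsetE _ F predT
  (patch (fun=> 0) D (fun i => f i *: tensor ip (e i) (e i) x))) /=.
rewrite [RHS]big_mkcond /=; apply: eq_bigr => i _.
by rewrite /patch; case: ifP => // _; rewrite /tensor scalerA.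
Qed.

Lemma orthonormal_sum_coord f x F j :
  (forall i k, D i -> D k -> ip (e i) (e k) = (i == k)%:R) -> D j ->
  ip (e j) (diag_sum f x F) = if j \in F then f j * ip (e j) x else 0.
Proof.
move=> on Dj; rewrite diag_sumE ip_sumr.
rewrite big_mkcond (eq_bigr (fun i => if i == j then f j * ip (e j) x else 0)).
  rewrite -big_mkcond /=; case: ifPn => jF.
    by rewrite -big_filter filter_pred1_uniq // ?big_seq1 //.
  rewrite big_seq_cond big1 // => i /andP[iF /eqP ij].
  by rewrite -ij iF in jF.
move=> i _; case: ifPn => [/set_mem Di|/negP iD].
  rewrite ipZr on // eq_sym; case: eqP => [->|]; by rewrite ?mulr1 ?mulr0.
by case: eqP => // ij; case: iD; rewrite ij mem_set.
Qed.

Lemma ip_basis i j : D i -> D j -> ip (e i) (e j) = (i == j)%:R.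
Proof.
case: ob => o1 o2 _ Di Dj; have [<-|ij] := eqVneq i j; first exact: o1.
by rewrite o2 //; apply/eqP.
Qed.

Lemma diag_sum_coord f x F j : D j ->
  ip (e j) (diag_sum f x F) = if j \in F then f j * ip (e j) x else 0.
Proof. exact: (orthonormal_sum_coord _ _ _ (@ip_basis)). Qed.

Lemma sqnorm_diag_sum f x F :
  `|diag_sum f x F| ^+ 2 = \sum_(i <- F | i \in D) (f i * ip (e i) x) ^+ 2.
Proof.
rewrite -ipN {1}diag_sumE ip_suml big_seq_cond [RHS]big_seq_cond.
apply: eq_bigr => i /andP[iF /set_mem Di].
by rewrite ipZl diag_sum_coord // iF expr2.
Qed.

Lemma le_diag_sum f g x y F :
  (forall i, D i -> `|f i * ip (e i) x| <= `|g i * ip (e i) y|) ->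
  `|diag_sum f x F| <= `|diag_sum g y F|.
Proof.
move=> fg; rewrite -(@ler_pXn2r _ 2) ?nnegrE // !sqnorm_diag_sum.
apply: ler_sum => i /set_mem Di.
by rewrite -[leLHS]real_normK ?num_real // -[leRHS]real_normK ?num_real // ler_pXn2r ?nnegrE // fg.
Qed.

Lemma diag_sum1_cvg x : diag_sum (fun=> 1) x @ tot --> x.
Proof.
case: ob => _ _ /(_ x); congr (_ @ tot --> x).
congr summability.partial_sum; apply/funext => i.
by rewrite /patch; case: ifP => // _; rewrite scale1r.
Qed.

Lemma norm_diag_sum1_cvg (x : V) :
  `|diag_sum (fun=> 1) x F| @[F --> tot] --> `|x|.
Proof. by apply: cvg_norm; exact: diag_sum1_cvg. Qed.

Lemma coord_ext x y : (forall i, D i -> ip (e i) x = ip (e i) y) -> x = y.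
Proof.
move=> xy; have hx := @diag_sum1_cvg x; have hy := @diag_sum1_cvg y.
have xyF : diag_sum (fun=> 1) x = diag_sum (fun=> 1) y.
  apply/funext => F; rewrite !diag_sumE; apply: eq_bigr => i /set_mem Di.
  by rewrite xy.
by rewrite xyF in hx; exact: (norm_cvg_unique hx hy).
Qed.

Lemma le_norm_coord x y :
  (forall i, D i -> `|ip (e i) x| <= `|ip (e i) y|) -> `|x| <= `|y|.
Proof.
move=> xy.
have hx := @norm_diag_sum1_cvg x; have hy := @norm_diag_sum1_cvg y.
apply: (ler_limit totF hx hy) => F.
by apply: le_diag_sum => i Di; rewrite !mul1r xy.
Qed.

Lemma bessel f x F : (forall i, D i -> `|f i| <= 1) -> `|diag_sum f x F| <= `|x|.
Proof.
move=> f1; apply: le_norm_coord => i Di; rewrite diag_sum_coord //.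
by case: ifP => _; rewrite ?normr0 // normrM ler_piMl // f1.
Qed.

Definition bounded_symbol (f : I -> R) := exists C, forall i, D i -> `|f i| <= C.

Lemma diag_sum_setD f x F G : (G `<=` F)%fset ->
  diag_sum f x F - diag_sum f x G = diag_sum f x (F `\` G)%fset.
Proof.
move=> GF; apply: coord_ext => i Di; rewrite ipBr !diag_sum_coord // inE.
case: (boolP (i \in G)) => iG /=; last by rewrite subr0.
by rewrite (fsubsetP GF) // subrr.
Qed.

(** Summability of a bounded diagonal operator is inherited from the
    expansion of the identity: on every finite set of indices the partial sums
    of the former are dominated by those of the latter. *)
Lemma diagop_cvg f x : bounded_symbol f -> diag_sum f x @ tot --> diagop f x.
Proof.
case=> C fC.
suff: cvg (diag_sum f x @ tot) by [].
apply: cauchy_cvg; apply: cauchy_exP => eps eps0.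
have K0 : 0 < `|C| + 1 by rewrite ltr_wpDl.
have e2 : 0 < eps / (`|C| + 1) / 2 by rewrite !divr_gt0.
have /cvgrPdist_lt /(_ _ e2) [F0 _ F0P] := @diag_sum1_cvg x.
exists (diag_sum f x F0); exists F0 => // F /= F0F.
rewrite -ball_normE /= distrC diag_sum_setD //.
rewrite (@le_lt_trans _ _ `|diag_sum (fun=> `|C| + 1) x (F `\` F0)%fset|) //.
  apply: le_diag_sum => i Di; rewrite !normrM ler_wpM2r //.
  by rewrite (le_trans (fC _ Di)) // [leRHS]ger0_norm ?(ltW K0)// (le_trans (ler_norm _)) // lerDl.
have -> : diag_sum (fun=> `|C| + 1) x (F `\` F0)%fset =
    (`|C| + 1) *: diag_sum (fun=> 1) x (F `\` F0)%fset.
  by apply: coord_ext => i Di; rewrite ipZr !diag_sum_coord //; case: ifP; rewrite ?mulr0 ?mul1r.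
rewrite normrZ gtr0_norm // mulrC -ltr_pdivlMr // -diag_sum_setD //.
have := F0P _ F0F; have := F0P _ (fsubset_refl F0) => /= h1 h2.
rewrite -(subrKA x) (le_lt_trans (ler_normD _ _)) // [ltRHS]splitr ltrD // distrC //.
Qed.

Lemma ip_diagop_cvg f x v : bounded_symbol f ->
  ip v (diag_sum f x F) @[F --> tot] --> ip v (diagop f x).
Proof. by move=> bf; apply: cvg_ipr => //; exact: diagop_cvg. Qed.

Lemma diagop_coord f x j : bounded_symbol f -> D j ->
  ip (e j) (diagop f x) = f j * ip (e j) x.
Proof.
move=> bf Dj.
have h := @ip_diagop_cvg f x (e j) bf.
have h2 : ip (e j) (diag_sum f x F) @[F --> tot] --> f j * ip (e j) x.
  apply: cvg_near_cst.
  exists [fset j]%fset => // F /= jF; rewrite diag_sum_coord //.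
  by rewrite (fsubsetP jF) ?inE.
exact: (cvg_unique (@Rhausdorff R) h h2).
Qed.

Lemma diagop_self_adjoint f : bounded_symbol f -> self_adjoint ip (diagop f).
Proof.
move=> bf x y; rewrite ipC.
have h := @ip_diagop_cvg f x y bf.
have h2 := @ip_diagop_cvg f y x bf.
have fxy : (fun F => ip y (diag_sum f x F)) = (fun F => ip x (diag_sum f y F)).
  apply/funext => F; rewrite !diag_sumE !ip_sumr; apply: eq_bigr => i _.
  by rewrite !ipZr !(ipC _ (e i)); ring.
by rewrite fxy in h; exact: (cvg_unique (@Rhausdorff R) h h2).
Qed.

Lemma parseval x :
  (\esum_(i in D) ((ip (e i) x) ^+ 2)%:E = (`|x| ^+ 2)%:E)%E.
Proof.
have sumE A : fsets D A ->
    (\sum_(i \in A) ((ip (e i) x) ^+ 2)%:E =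
     (`|diag_sum (fun=> 1) x (fset_set A)| ^+ 2)%:E)%E.
  case=> finA AD; rewrite fsbig_finite //= sumEFin sqnorm_diag_sum.
  congr EFin; rewrite big_seq_cond [RHS]big_seq_cond; apply: eq_big => [i|i _].
    rewrite andbT; case: (boolP (i \in fset_set A)) => //= iA.
    by rewrite mem_set //; apply: AD; rewrite in_fset_set // in iA; exact: set_mem.
  by rewrite mul1r.
apply/eqP; rewrite eq_le; apply/andP; split.
  apply: ge_ereal_sup => _ [A Af <-]; rewrite sumE // lee_fin ler_pXn2r ?nnegrE //.
  by apply: bessel => i _; rewrite normr1.
have hx := @norm_diag_sum1_cvg x.
have hx2 : `|diag_sum (fun=> 1) x F| * `|diag_sum (fun=> 1) x F| @[F --> tot]
    --> `|x| * `|x| by apply: cvgM.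
apply/lee_addgt0Pr => eps eps0.
move: hx2 => /cvgrPdist_lt /(_ _ eps0) [F0 _ /(_ F0 (fsubset_refl _))] /=.
rewrite -!expr2 => /ltr_normlW h.
rewrite (@le_trans _ _ ((`|diag_sum (fun=> 1) x F0| ^+ 2)%:E + eps%:E)%E) //.
  by rewrite -EFinD lee_fin; lra.
rewrite leeD2r //.
have fs : fsets D [set i | i \in F0 /\ D i].
  by split=> [|i []//]; apply: (sub_finite_set _ (finite_fset F0)) => i [].
apply: esum_ge; exists [set i | i \in F0 /\ D i] => //.
rewrite sumE // lee_fin le_eqVlt; apply/orP; left; apply/eqP; congr (`|_| ^+ 2).
apply: coord_ext => i Di; rewrite !diag_sum_coord // in_fset_set ?(proj1 fs) //.
have [iF|iF] := boolP (i \in F0); first by rewrite mem_set.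
by rewrite memNset //= => -[iF']; rewrite iF' in iF.
by case: fs.
Qed.

End OrthonormalBasis.

(** * Hilbert-Schmidt norms *)

Section HilbertSchmidt.
Context {R : realType} {V : completeNormedModType R}.
Variable ip : {dot V for @idfun R}.
Hypothesis ipN : norm_induced_by ip.
#[local] Existing Instance summability.totally_filter.

(** Squared, so that orthogonal decompositions are sums, and over an explicit
    basis, because [hs_norm] refers to a basis obtained by choice. *)
Definition sq_hs (I : choiceType) (D : set I) (e : I -> V) (A : V -> V) : \bar R :=
  (\esum_(i in D) (`|A (e i)| ^+ 2)%:E)%E.

Lemma esum_exchange (I I' : choiceType) (D : set I) (D' : set I')
    (a : I -> I' -> \bar R) : (forall i j, 0 <= a i j)%E ->
  (\esum_(i in D) \esum_(j in D') a i j = \esum_(j in D') \esum_(i in D) a i j)%E.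
Proof.
move=> a0; rewrite !(@esum_esum _ _ _ _ (fun=> _)) //.
rewrite (reindex_esum (D' `*`` fun=> D) _ (fun x => (x.2, x.1)))//; split=> //=.
- by move=> [i j] [/=].
- by move=> [i1 i2] [j1 j2] /= _ _ [] -> ->.
- by move=> [i1 i2] [Pi1 Qi2] /=; exists (i2, i1).
Qed.

(** Expanding [A (e i)] in the second basis gives a double series of squared
    matrix entries, whose transpose is the one of the adjoint. *)
Lemma sq_hs_adjoint (I I' : choiceType) (D : set I) (D' : set I')
    (e : I -> V) (e' : I' -> V) (A B : V -> V) :
  orthonormal_basis ip D e -> orthonormal_basis ip D' e' ->
  adjoint_pair ip A B -> sq_hs D e A = sq_hs D' e' B.
Proof.
move=> ob ob' AB; rewrite /sq_hs.
under eq_esum => i _ do rewrite -(parseval ipN ob').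
under [RHS]eq_esum => i _ do rewrite -(parseval ipN ob).
rewrite esum_exchange; last by move=> i j; rewrite lee_fin sqr_ge0.
by apply: eq_esum => j _; apply: eq_esum => i _; rewrite ipC AB.
Qed.

Section FixedBasis.
Variables (I : choiceType) (D : set I) (e : I -> V).
Hypothesis ob : orthonormal_basis ip D e.
Local Notation hs := (sq_hs D e).

Lemma sq_hs_ge0 A : (0 <= hs A)%E.
Proof. by apply: esum_ge0 => i _; rewrite lee_fin sqr_ge0. Qed.

Lemma sq_hs_le_comb (A B C : V -> V) (c1 c2 M1 M2 : R) :
  0 <= c1 -> 0 <= c2 ->
  (forall i, D i -> `|A (e i)| ^+ 2 <= c1 * `|B (e i)| ^+ 2 + c2 * `|C (e i)| ^+ 2) ->
  (hs B <= M1%:E)%E -> (hs C <= M2%:E)%E -> (hs A <= (c1 * M1 + c2 * M2)%:E)%E.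
Proof.
move=> c10 c20 ABC BM CM.
have finsum (G : V -> V) X : fsets D X ->
    (\sum_(i \in X) (`|G (e i)| ^+ 2)%:E =
     (\sum_(i <- fset_set X) `|G (e i)| ^+ 2)%:E)%E.
  by move=> [fX _]; rewrite fsbig_finite //= sumEFin.
have ub (G : V -> V) (M : R) X : (hs G <= M%:E)%E -> fsets D X ->
    \sum_(i <- fset_set X) `|G (e i)| ^+ 2 <= M.
  move=> GM fX; rewrite -lee_fin -finsum //; apply: le_trans GM.
  by apply: esum_ge; exists X.
apply: ge_ereal_sup => _ [X fX <-]; rewrite finsum // lee_fin.
apply: (@le_trans _ _ (c1 * (\sum_(i <- fset_set X) `|B (e i)| ^+ 2) +
                       c2 * (\sum_(i <- fset_set X) `|C (e i)| ^+ 2))).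
  rewrite !mulr_sumr -big_split /= big_seq [leRHS]big_seq.
  apply: ler_sum => i; case: (fX) => finX XD; rewrite in_fset_set // => /set_mem iX.
  exact/ABC/XD.
by apply: lerD; apply: ler_wpM2l => //; exact: ub.
Qed.

Lemma sq_hs_le_scale (A B : V -> V) (c M : R) : 0 <= c ->
  (forall i, D i -> `|A (e i)| <= c * `|B (e i)|) ->
  (hs B <= M%:E)%E -> (hs A <= (c ^+ 2 * M)%:E)%E.
Proof.
move=> c0 AB BM; rewrite -[X in X%:E]addr0 -(mul0r M).
apply: (sq_hs_le_comb (B := B) (C := B)) => //; first exact: sqr_ge0.
by move=> i Di; rewrite mul0r addr0 -exprMn ler_pXn2r ?nnegrE ?mulr_ge0 // AB.
Qed.

Lemma sq_hs_eqD (A B C : V -> V) :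
  (forall i, D i -> `|A (e i)| ^+ 2 = `|B (e i)| ^+ 2 + `|C (e i)| ^+ 2) ->
  (hs A = hs B + hs C)%E.
Proof.
move=> ABC; rewrite /sq_hs -esumD; try by move=> i _; rewrite lee_fin sqr_ge0.
by apply: eq_esum => i Di; rewrite ABC // EFinD.
Qed.

Lemma sq_hs_fset (F : {fset I}) (A : V -> V) :
  (forall i, i \in F -> D i) -> (forall i, D i -> i \notin F -> A (e i) = 0) ->
  hs A = (\sum_(i <- F) `|A (e i)| ^+ 2)%:E.
Proof.
move=> FD A0; rewrite /sq_hs (esumID [set` F]) /=; last first.
  by move=> i _; rewrite lee_fin sqr_ge0.
rewrite [X in (_ + X)%E]esum1 ?adde0; last first.
  move=> i [Di /negP iF]; rewrite A0 // ?normr0 ?expr0n //.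
rewrite setIidr; last by move=> i; exact: FD.
rewrite esum_fset //; do ?by move=> i _; rewrite lee_fin sqr_ge0.
by rewrite fsbig_finite //= set_fsetK sumEFin.
Qed.

Lemma sq_hs_compr (A A' B B' : V -> V) (C M : R) :
  adjoint_pair ip A A' -> adjoint_pair ip B B' -> 0 <= C -> opbound B C ->
  (hs A <= M%:E)%E -> (hs (A \o B) <= (C ^+ 2 * M)%:E)%E.
Proof.
move=> AA BB C0 BC AM.
have BA : adjoint_pair ip (A \o B) (B' \o A') by move=> x y; rewrite /= AA BB.
rewrite (sq_hs_adjoint ob ob BA).
apply: (sq_hs_le_scale (B := A')) => //.
  by move=> i _ /=; apply: (opbound_adj ipN BB).
by rewrite -(sq_hs_adjoint ob ob AA).
Qed.

(** A basis indexed by an arbitrary set is turned into a set of vectors: the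
    projection onto the span of more basis vectors is closer to the identity,
    so convergence transfers through the bijection of the index sets. *)
Lemma basis_image : orthonormal_basis ip (e @` D) id.
Proof.
set D' := e @` D.
have einj i j : D i -> D j -> e i = e j -> i = j.
  move=> Di Dj ij; apply/eqP; have := ip_basis ob Di Dj.
  by rewrite ij (ip_basis ob Dj Dj) eqxx; case: eqP => // _ /eqP; rewrite oner_eq0.
have on u v : D' u -> D' v -> ip u v = (u == v)%:R.
  move=> [i Di <-] [j Dj <-]; rewrite (ip_basis ob) //; congr (nat_of_bool _)%:R.
  by apply/eqP/eqP => [->//|]; exact: einj.
split=> [u uD'|u v uD' vD'|x]; first by rewrite on // eqxx.
  by rewrite on //; case: eqP => // ->.
apply/cvgrPdist_lt => eps eps0.
have /cvgrPdist_lt /(_ _ eps0) [F0 _ F0P] := @diag_sum1_cvg _ _ _ _ _ _ ob x.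
exists (e @` F0)%fset => // G /= F0G.
apply: le_lt_trans (F0P _ (fsubset_refl F0)).
have -> : summability.partial_sum (patch (fun=> 0) D' (fun i => tensor ip i i x)) G
    = diag_sum ip D' id (fun=> 1) x G.
  congr (summability.partial_sum _ G); apply/funext => v.
  by rewrite /patch; case: ifP => // _; rewrite scale1r.
apply: (le_norm_coord ipN ob) => i Di.
rewrite !ipBr (diag_sum_coord ob) // -[X in ip X (diag_sum _ _ id _ _ _)]/(id (e i)).
rewrite (orthonormal_sum_coord _ _ _ on) ?mul1r; last by exists i.
case: ifPn => [iG|iG]; first by rewrite subrr normr0.
rewrite ifF //; apply/negP => iF; move/negP: iG; apply.
by apply: (fsubsetP F0G); apply/imfsetP; exists i.
Qed.

(** The basis chosen inside [hs_norm] exists by [basis_image], and the choice is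
    immaterial by [sq_hs_adjoint] applied twice. *)
Lemma hs_normE (A B : V -> V) : adjoint_pair ip A B ->
  hs_norm ip A = sqrte (hs A).
Proof.
move=> AB; rewrite /hs_norm; set b := get _.
have bob : orthonormal_basis ip b id.
  by apply: (getPex (P := fun b : set V => orthonormal_basis ip b id)); eexists; exact: basis_image.
have AA : adjoint_pair ip B A by move=> x y; rewrite ipC -AB ipC.
congr sqrte; rewrite -[LHS]/(sq_hs b id A).
by rewrite (sq_hs_adjoint bob ob AB) (sq_hs_adjoint ob ob AA).
Qed.

End FixedBasis.
End HilbertSchmidt.

(** * Linear maps, quadratic forms and contractions *)

Section Operators.
Context {R : realType} {V : completeNormedModType R}.
Variable ip : {dot V for @idfun R}.
Hypothesis ipN : norm_induced_by ip.

Section LinearTheory.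
Variable A : V -> V.
Hypothesis linA : linear A.

Lemma linD x y : A (x + y) = A x + A y.
Proof. by rewrite -[x]scale1r linA !scale1r. Qed.

Lemma lin0 : A 0 = 0.
Proof. by apply: (addIr (A 0)); rewrite -linD !add0r. Qed.

Lemma linZ a x : A (a *: x) = a *: A x.
Proof. by rewrite -[a *: x]addr0 linA lin0 addr0. Qed.

Lemma linN x : A (- x) = - A x.
Proof. by rewrite -scaleN1r linZ scaleN1r. Qed.

Lemma linB x y : A (x - y) = A x - A y.
Proof. by rewrite linD linN. Qed.

Lemma lin_sum (I : Type) (r : seq I) (F : I -> V) :
  A (\sum_(i <- r) F i) = \sum_(i <- r) A (F i).
Proof.
elim: r => [|i r IH]; first by rewrite !big_nil lin0.
by rewrite !big_cons linD IH.
Qed.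

End LinearTheory.

Lemma lin_comp (A B : V -> V) : linear A ->
  linear B -> linear (A \o B).
Proof. by move=> lA lB a x y; rewrite /= lB lA. Qed.

Section Diagonal.
Variables (I : choiceType) (D : set I) (e : I -> V).
Hypothesis ob : orthonormal_basis ip D e.

Local Notation dg := (diagop ip D e).

Lemma diagop_lin f : bounded_symbol D f -> linear (dg f).
Proof.
move=> bf a x y; apply: (coord_ext ob) => i Di.
by rewrite ipDr ipZr !(diagop_coord ipN ob) // ipDr ipZr mulrDr mulrCA.
Qed.

Lemma diagop_le f x C : (forall i, D i -> `|f i| <= C) -> `|dg f x| <= C * `|x|.
Proof.
move=> fC; have [DI|D0] := pselect (exists i, D i); last first.
  have -> : dg f x = 0 by apply: (coord_ext ob) => i Di; case: D0; exists i.
  suff -> : x = 0 by rewrite normr0 mulr0.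
  by apply: (coord_ext ob) => i Di; case: D0; exists i.
have C0 : 0 <= C by case: DI => i Di; exact: le_trans (normr_ge0 _) (fC _ Di).
rewrite -[C in leRHS]ger0_norm // -normrZ; apply: (le_norm_coord ipN ob) => i Di.
rewrite (diagop_coord ipN ob) //; last by exists C.
by rewrite ipZr !normrM (ger0_norm C0) ler_wpM2r // fC.
Qed.

Lemma series_over_diagop (D' : set I) f x : D' `<=` D ->
  series_over D' (fun i => f i *: tensor ip (e i) (e i) x) =
  dg (fun i => if i \in D' then f i else 0) x.
Proof.
move=> DD; rewrite /diagop /series_over.
congr (summability.sum _); apply/funext => i; rewrite /patch.
case: (boolP (i \in D')) => iD'; last by rewrite scale0r if_same.
by rewrite ifT //; apply: mem_set; apply: DD; exact: set_mem.
Qed.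

(** The difference [g - f], cut off at zero, is the square of a symbol; cutting it
    off is harmless where the coordinate of [x] vanishes. *)
Lemma diagop_form_le f g x : bounded_symbol D f -> bounded_symbol D g ->
  (forall i, D i -> ip (e i) x != 0 -> f i <= g i) ->
  ip x (dg f x) <= ip x (dg g x).
Proof.
move=> bf bg fg.
pose h i := Num.sqrt (Num.max (g i - f i) 0).
have bh : bounded_symbol D h.
  case: bf bg => [C fC] [C' gC]; exists (Num.sqrt (C' + C)) => i Di.
  rewrite ger0_norm ?sqrtr_ge0 // /h; have := fC _ Di; have := gC _ Di.
  rewrite !ler_norml => /andP[_ h1] /andP[h2 _].
  have : Num.max (g i - f i) 0 <= Num.max (C' + C) 0.
    by rewrite ge_max !le_max lexx orbT andbT; apply/orP; left; lra.
  move=> h3; apply: (le_trans (ler_wsqrtr h3)).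
  have [h4|h4] := leP (C' + C) 0; last by [].
  by rewrite sqrtr0 sqrtr_ge0.
have -> : dg g x = dg f x + dg h (dg h x).
  apply: (coord_ext ob) => i Di; rewrite ipDr !(diagop_coord ipN ob) //.
  have [->|xi0] := eqVneq (ip (e i) x) 0; first by rewrite !mulr0 addr0.
  rewrite mulrA /h -expr2 sqr_sqrtr ?le_max ?lexx ?orbT //.
  have gf := fg _ Di xi0.
  by rewrite max_l ?subr_ge0 // -mulrDl addrC subrK.
by rewrite ipDr -(diagop_self_adjoint ipN ob bh) ipN lerDl sqr_ge0.
Qed.

End Diagonal.

(** Iterating the improvement from the a priori bound [C0] converges to its fixed
    point. *)
Lemma contraction_bound (X : V -> Prop) (f : V -> R) (C0 th mu : R) :
  0 <= th -> th < 1 -> 0 <= mu -> (forall x, X x -> f x <= C0 * `|x|) ->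
  (forall C, 0 <= C -> (forall x, X x -> f x <= C * `|x|) ->
     forall x, X x -> f x <= (th * C + mu) * `|x|) ->
  forall x, X x -> f x <= mu / (1 - th) * `|x|.
Proof.
move=> th0 th1 mu0 fC0 fstep x Xx.
pose N := mu / (1 - th).
have N0 : 0 <= N by rewrite divr_ge0 // subr_ge0 ltW.
have Nfix : th * N + mu = N by rewrite /N; field; rewrite gt_eqF // subr_gt0.
have fn n : forall x, X x -> f x <= (N + th ^+ n * `|C0|) * `|x|.
  elim: n => [|n IH].
    move=> y Xy; rewrite (le_trans (fC0 _ Xy)) // ler_wpM2r //.
    by rewrite expr0 mul1r (le_trans (ler_norm _)) // lerDr.
  have -> : N + th ^+ n.+1 * `|C0| = th * (N + th ^+ n * `|C0|) + mu.
    by rewrite -[in LHS]Nfix exprS; ring.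
  by apply: fstep => //; rewrite addr_ge0 // mulr_ge0 // exprn_ge0.
have lim : (fun n => (N + th ^+ n * `|C0|) * `|x|) @ \oo --> (N + 0 * `|C0|) * `|x|.
  apply: cvgM; last exact: cvg_cst.
  apply: cvgD; first exact: cvg_cst.
  apply: cvgM; last exact: cvg_cst.
  by apply: cvg_expr; rewrite ger0_norm.
rewrite mul0r addr0 in lim.
apply: (ler_limit (f := fun=> f x) _ (cvg_cst _) lim) => n; exact: fn.
Qed.

Lemma sqr_sum_le (I : eqType) (r : seq I) (F : I -> R) :
  (\sum_(i <- r) F i) ^+ 2 <= (size r)%:R * \sum_(i <- r) F i ^+ 2.
Proof.
elim: r => [|i r IH]; first by rewrite !big_nil expr0n mul0r.
rewrite !big_cons /= -natr1.
have [->|r0] := eqVneq r [::]; first by rewrite !big_nil /=; lra.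
have n0 : 0 < (size r)%:R :> R by rewrite ltr0n lt0n size_eq0.
move: IH n0; move: (\sum_(j <- r) F j) (\sum_(j <- r) F j ^+ 2) (size r)%:R (F i).
move=> S Q n u IH n0.
have : 0 <= (n * u - S) ^+ 2 by exact: sqr_ge0.
have : 0 <= n^-1 * ((n * u - S) ^+ 2 + (n * Q - S ^+ 2)).
  by rewrite mulr_ge0 ?invr_ge0 ?(ltW n0) // addr_ge0 ?sqr_ge0 // subr_ge0.
have -> : n^-1 * ((n * u - S) ^+ 2 + (n * Q - S ^+ 2)) = n * u ^+ 2 - 2 * u * S + Q.
  by field; rewrite gt_eqF.
by nra.
Qed.

End Operators.

(** * Spectral projections and the min-max vector *)

Section Spectral.
Context {R : realType} {V : completeNormedModType R}.
Variable ip : {dot V for @idfun R}.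
Hypothesis ipN : norm_induced_by ip.

(** Symbol of the diagonal operator [PJ s K]. *)
Definition in_block (K : {fset nat}) (i : nat + nat) : R :=
  if i is inl k then (k \in K)%:R else 0.

Definition used_block (s : eigensystem V) (K : {fset nat}) :=
  forall k, k \in K -> eigidx s (inl k).

Section OneSystem.
Variables (s : eigensystem V) (H : V -> V).
Hypothesis Hself : self_adjoint ip H.
Hypothesis es : is_eigensystem ip H s.
Local Notation D := (eigidx s).
Local Notation lam := (eigval s).
Local Notation psi := (eigvec s).
Local Notation dg := (diagop ip D psi).

Lemma eigsys_basis : orthonormal_basis ip D psi.
Proof. by case: es. Qed.

Lemma eigval_bounded : bounded_symbol D lam.
Proof.
case: es => _ _ mono pos ker.
exists (`|lam (inl 0%N)|) => -[k|j] Di; rewrite ger0_norm ?pos //; last first.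
  by rewrite ker.
have [D0 le0] := mono 0%N k (leq0n _) Di.
exact: le_trans le0 (ler_norm _).
Qed.

Lemma eigval_coord x i : D i -> ip (psi i) (H x) = lam i * ip (psi i) x.
Proof.
by move=> Di; case: es => _ eig _ _ _; rewrite -Hself eig // ipZl.
Qed.

Lemma eig_diagop x : H x = dg lam x.
Proof.
apply: (coord_ext eigsys_basis) => i Di; rewrite eigval_coord //.
by rewrite (diagop_coord ipN eigsys_basis) //; exact: eigval_bounded.
Qed.

Lemma in_block_bounded K : bounded_symbol D (in_block K).
Proof.
by exists 1 => -[k|j] _; rewrite /= ?normr0 //; case: (k \in K); rewrite ?normr1 ?normr0.
Qed.

Lemma PJ_coord K x i : used_block s K -> D i ->
  ip (psi i) (PJ ip s K x) = in_block K i * ip (psi i) x.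
Proof.
move=> KD Di; rewrite /PJ ip_sumr.
rewrite big_seq_cond (eq_bigr (fun k => if i == inl k then ip (psi i) x else 0)); last first.
  move=> k /andP[kK _]; rewrite /Qproj /tensor ipZr (ip_basis eigsys_basis) //; last exact: KD.
  by case: eqP => [->|_]; rewrite ?mulr1 ?mulr0.
rewrite -big_seq_cond; case: i Di => [k|j] Di /=; last first.
  by rewrite mul0r big1.
rewrite -big_mkcond /=; case: (boolP (k \in K)) => kK.
  rewrite (eq_bigl (pred1 k)); last by move=> k' /=; rewrite eq_sym; apply/eqP/eqP => [[->]|->].
  by rewrite -big_filter filter_pred1_uniq ?fset_uniq // big_seq1 mul1r.
rewrite mul0r big_seq_cond big1 // => k' /andP[k'K /eqP [kk']].
by rewrite kk' k'K in kK.
Qed.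

Lemma PJ_diagop K x : used_block s K -> PJ ip s K x = dg (in_block K) x.
Proof.
move=> KD; apply: (coord_ext eigsys_basis) => i Di; rewrite PJ_coord //.
by rewrite (diagop_coord ipN eigsys_basis) //; exact: in_block_bounded.
Qed.

Lemma PJ_lin K : used_block s K -> linear (PJ ip s K).
Proof.
move=> KD a x y; apply: (coord_ext eigsys_basis) => i Di.
by rewrite ipDr ipZr !PJ_coord // ipDr ipZr mulrDr mulrCA.
Qed.

Lemma PJ_self_adjoint K : used_block s K -> self_adjoint ip (PJ ip s K).
Proof.
move=> KD x y; rewrite !PJ_diagop //.
apply: (diagop_self_adjoint ipN eigsys_basis); exact: in_block_bounded.
Qed.

Lemma in_block_sqr K i : in_block K i * in_block K i = in_block K i.
Proof. by case: i => [k|j] /=; rewrite ?mulr0 //; case: (k \in K); rewrite ?mulr1 ?mulr0. Qed.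

Lemma PJ_idem K x : used_block s K -> PJ ip s K (PJ ip s K x) = PJ ip s K x.
Proof.
move=> KD; apply: (coord_ext eigsys_basis) => i Di.
by rewrite !PJ_coord // mulrA in_block_sqr.
Qed.

Lemma PJ_sub K K' x : {subset K <= K'} -> used_block s K' ->
  PJ ip s K' (PJ ip s K x) = PJ ip s K x.
Proof.
move=> KK' KD'; have KD : used_block s K by move=> k /KK'; exact: KD'.
apply: (coord_ext eigsys_basis) => i Di; rewrite !PJ_coord // mulrA; congr (_ * _).
case: i Di => [k|j] _ /=; last by rewrite mulr0.
by case: (boolP (k \in K)) => [/KK' ->|]; rewrite ?mulr1 ?mulr0.
Qed.

Lemma PJ_comm K x : used_block s K -> PJ ip s K (H x) = H (PJ ip s K x).
Proof.
move=> KD; apply: (coord_ext eigsys_basis) => i Di.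
by rewrite PJ_coord // !eigval_coord // PJ_coord // mulrCA.
Qed.

Lemma PJ_orth K x y : used_block s K -> ip (PJ ip s K x) (y - PJ ip s K y) = 0.
Proof. by move=> KD; rewrite PJ_self_adjoint // (linB (PJ_lin KD)) PJ_idem // subrr ip0r. Qed.

Lemma PJ_pythagoras K x : used_block s K ->
  `|x| ^+ 2 = `|PJ ip s K x| ^+ 2 + `|x - PJ ip s K x| ^+ 2.
Proof.
move=> KD; rewrite -(pythagoras ipN) ?PJ_orth //.
by rewrite addrC subrK.
Qed.

Lemma PJ_norm K x : used_block s K -> `|PJ ip s K x| <= `|x|.
Proof.
move=> KD; rewrite -(@ler_pXn2r _ 2) ?nnegrE //.
by rewrite [leRHS](PJ_pythagoras x KD) lerDl sqr_ge0.
Qed.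

Lemma PJC_norm K x : used_block s K -> `|x - PJ ip s K x| <= `|x|.
Proof.
move=> KD; rewrite -(@ler_pXn2r _ 2) ?nnegrE //.
by rewrite [leRHS](PJ_pythagoras x KD) lerDr sqr_ge0.
Qed.

Lemma PJ_basis K k : used_block s K -> k \in K ->
  PJ ip s K (psi (inl k)) = psi (inl k).
Proof.
move=> KD kK; apply: (coord_ext eigsys_basis) => i Di; rewrite PJ_coord //.
rewrite (ip_basis eigsys_basis) //; last exact: KD.
by case: eqP => [->|_]; rewrite ?mulr0 //= kK mulr1.
Qed.

Lemma PJ_out K i : used_block s K -> D i -> in_block K i = 0 ->
  PJ ip s K (psi i) = 0.
Proof.
move=> KD Di iK; apply: (coord_ext eigsys_basis) => j Dj; rewrite PJ_coord // ip0r.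
rewrite (ip_basis eigsys_basis) //.
by case: eqP => [->|_]; rewrite ?mulr0 // iK mul0r.
Qed.

Lemma block_shift_norm K (c rho : R) x : used_block s K ->
  (forall k, k \in K -> `|lam (inl k) - c| <= rho) -> 0 <= rho ->
  PJ ip s K x = x -> `|H x - c *: x| <= rho * `|x|.
Proof.
move=> KD lamc rho0 Kx.
rewrite -[rho in leRHS]ger0_norm // -normrZ; apply: (le_norm_coord ipN eigsys_basis).
move=> i Di; rewrite ipBr eigval_coord // !ipZr -mulrBl !normrM (ger0_norm rho0).
rewrite -Kx PJ_coord //; case: i Di => [k|j] Di /=.
  case: (boolP (k \in K)) => kK; last by rewrite mul0r normr0 !mulr0.
  by rewrite ler_wpM2r // lamc.
by rewrite mul0r normr0 !mulr0.
Qed.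

Lemma block_shift_stable K c x : used_block s K -> linear H ->
  PJ ip s K x = x -> PJ ip s K (H x - c *: x) = H x - c *: x.
Proof.
by move=> KD lH Kx; rewrite (linB (PJ_lin KD)) (linZ (PJ_lin KD)) PJ_comm // Kx.
Qed.

End OneSystem.

(** Dimension count behind the min-max principle: a matrix with one more row than
    columns has a nonzero row kernel. *)
Lemma minmax_vector (I : choiceType) (D : set I) (e : I -> V) (n : nat)
    (f : 'I_n.+1 -> I) (g : 'I_n -> V) :
  orthonormal_basis ip D e -> injective f -> (forall j, D (f j)) ->
  exists x, [/\ x != 0, forall m, ip (g m) x = 0 &
    forall i, D i -> ip (e i) x != 0 -> exists j, i = f j].
Proof.
move=> ob finj fD.
pose M : 'M[R]_(n.+1, n) := \matrix_(j, m) ip (g m) (e (f j)).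
have kM : kermx M != 0.
  rewrite -mxrank_eq0 mxrank_ker -lt0n subn_gt0 ltnS; exact: rank_leq_col.
have /rowV0Pn [u /sub_kermxP uM u0] := kM.
pose x := \sum_(j < n.+1) u 0 j *: e (f j).
have xc i : D i -> ip (e i) x = \sum_(j < n.+1) u 0 j * (i == f j)%:R.
  move=> Di; rewrite /x ip_sumr; apply: eq_bigr => j _.
  by rewrite ipZr (ip_basis ob).
exists x; split.
- apply/eqP => x0; move/eqP: u0; apply; apply/rowP => j; rewrite mxE.
  have := xc (f j) (fD j); rewrite x0 ip0r (bigD1 j) //= eqxx mulr1 big1 ?addr0 //.
  by move=> j' jj'; rewrite (inj_eq finj) eq_sym (negbTE jj') mulr0.
- move=> m; have := congr1 (fun w : 'rV_n => w 0 m) uM; rewrite !mxE => <-.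
  by rewrite /x ip_sumr; apply: eq_bigr => j _; rewrite ipZr !mxE.
- move=> i Di; rewrite xc // => s0.
  have [j /eqP ->|nj] := pickP (fun j => i == f j); first by exists j.
  by move: s0; rewrite big1 ?eqxx // => j _; rewrite nj mulr0.
Qed.

End Spectral.

(** * Orthogonal sums over buckets of indices *)

Section Buckets.
Context {R : realType} {V : completeNormedModType R}.
Variable ip : {dot V for @idfun R}.
Hypothesis ipN : norm_induced_by ip.
Variables (s : eigensystem V) (H : V -> V).
Hypothesis Hself : self_adjoint ip H.
Hypothesis es : is_eigensystem ip H s.
Variable J : {fset nat}.
Hypothesis JD : used_block s J.
Variable label : nat -> nat.

Definition bucket b : {fset nat} := [fset k in J | label k == b]%fset.
Definition labels : {fset nat} := [fset label k | k in J]%fset.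

Lemma bucket_sub b : {subset bucket b <= J}.
Proof. by move=> k; rewrite !inE /= => /andP[]. Qed.

Lemma PJ_bucket_sum x : PJ ip s J x = \sum_(b <- labels) PJ ip s (bucket b) x.
Proof.
rewrite /PJ /labels (partition_big_imfset _ label J) /=; apply: eq_bigr => b _.
by rewrite big_fset_condE.
Qed.

Lemma PJ_sqnorm K x : used_block s K -> `|PJ ip s K x| ^+ 2 = ip x (PJ ip s K x).
Proof. by move=> KD; rewrite -ipN (PJ_self_adjoint ipN es) // (PJ_idem es). Qed.

Lemma bucket_used b : used_block s (bucket b).
Proof. by move=> k /bucket_sub /JD. Qed.

Lemma bucket_sqnorm x :
  \sum_(b <- labels) `|PJ ip s (bucket b) x| ^+ 2 = `|PJ ip s J x| ^+ 2.
Proof.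
rewrite PJ_sqnorm // PJ_bucket_sum ip_sumr; apply: eq_bigr => b _.
by rewrite PJ_sqnorm //; exact: bucket_used.
Qed.

(** Triangle inequality over the pieces, then Cauchy-Schwarz against Pythagoras:
    this is where the factor [sqrt m] enters. *)
Lemma bucket_bound (B : V -> V) (C : R) : linear B -> 0 <= C ->
  (forall b x, b \in labels -> PJ ip s (bucket b) x = x -> `|B x| <= C * `|x|) ->
  forall x, PJ ip s J x = x -> `|B x| <= Num.sqrt (#|` labels|)%:R * C * `|x|.
Proof.
move=> linB0 C0 BC x Jx.
have -> : B x = \sum_(b <- labels) B (PJ ip s (bucket b) x).
  by rewrite -(lin_sum linB0) -PJ_bucket_sum Jx.
apply: (le_trans (ler_norm_sum _ _ _)).
apply: (@le_trans _ _ (C * \sum_(b <- labels) `|PJ ip s (bucket b) x|)).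
  rewrite mulr_sumr big_seq [leRHS]big_seq; apply: ler_sum => b bl; apply: (BC b) => //.
  by rewrite (PJ_idem es) //; exact: bucket_used.
rewrite (mulrC _ C) -mulrA ler_wpM2l //.
rewrite -(@ler_pXn2r _ 2) ?nnegrE ?mulr_ge0 ?sqrtr_ge0 ?sumr_ge0 //.
apply: le_trans (sqr_sum_le _ _) _.
by rewrite bucket_sqnorm Jx exprMn sqr_sqrtr // cardfE.
Qed.

End Buckets.

(** * Weights and the first-order term *)

Section Weights.
Context {R : realType} {V : completeNormedModType R}.
Variable ip : {dot V for @idfun R}.
Hypothesis ipN : norm_induced_by ip.
Variables (s : eigensystem V) (J : {fset nat}).
Local Notation D := (eigidx s).
Local Notation lam := (eigval s).
Local Notation psi := (eigvec s).
Local Notation dg := (diagop ip D psi).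
Local Notation gam := (gap s J).
Hypothesis ob : orthonormal_basis ip D psi.
Hypothesis lam_bounded : bounded_symbol D lam.
Hypothesis JD : used_block s J.
Hypothesis J0 : J != fset0.
Hypothesis gam0 : 0 < gam.

Definition dist i : R := dist_to s J (lam i).

Lemma offP i : off s J i <-> D i /\ in_block (R := R) J i = 0.
Proof.
split=> [[Di iJ]|[Di iJ]]; split=> //.
  case: i Di iJ => [k|j] Di iJ //=.
  by case: (boolP (k \in J)) => // kJ; case: iJ; exists k.
by move=> [k /= kJ ki]; move/eqP: iJ; rewrite -ki /= kJ oner_eq0.
Qed.

Lemma onP i : D i -> ~ off s J i -> exists2 k, k \in J & i = inl k.
Proof.
move=> Di noff; apply: contrapT => nk; apply: noff; split=> //.
by move=> [k /= kJ ki]; apply: nk; exists k.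
Qed.

Lemma off_used i : off s J i -> D i.
Proof. by case/offP. Qed.

Lemma gap_le k l : k \in J -> off s J l -> gam <= `|lam (inl k) - lam l|.
Proof.
move=> kJ lo; apply: ge_inf; last by exists k => //; exists l.
by exists 0 => _ [k' _ [l' _ <-]].
Qed.

Lemma dist_le i k : k \in J -> dist i <= `|lam i - lam (inl k)|.
Proof.
move=> kJ; apply: ge_inf; last by exists k.
by exists 0 => _ [k' _ <-].
Qed.

Lemma gap_le_dist l : off s J l -> gam <= dist l.
Proof.
move=> lo; apply: lb_le_inf.
  by case/fset0Pn: J0 => k kJ; exists (`|lam l - lam (inl k)|); exists k.
by move=> _ [k kJ <-]; rewrite distrC gap_le.
Qed.

Lemma dist_gt0 l : off s J l -> 0 < dist l.
Proof. by move=> lo; exact: lt_le_trans (gap_le_dist lo). Qed.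

(** Symbol of the inverse of [T_half]. *)
Definition wt i : R := if i \in off s J then Num.sqrt (dist i) else Num.sqrt gam.

Lemma wt_off l : off s J l -> wt l = Num.sqrt (dist l).
Proof. by move=> lo; rewrite /wt mem_set. Qed.

Lemma wt_on i : in_block (R := R) J i != 0 -> wt i = Num.sqrt gam.
Proof. by move=> iJ; rewrite /wt memNset // => /offP[_ iJ0]; rewrite iJ0 eqxx in iJ. Qed.

Lemma wt_ge i : D i -> Num.sqrt gam <= wt i.
Proof.
move=> Di; rewrite /wt; case: ifPn => // /set_mem lo.
by rewrite ler_wsqrtr // gap_le_dist.
Qed.

Lemma sqrt_gap_gt0 : 0 < Num.sqrt gam.
Proof. by rewrite sqrtr_gt0. Qed.

Lemma wt_gt0 i : D i -> 0 < wt i.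
Proof. move=> Di; exact: lt_le_trans sqrt_gap_gt0 (wt_ge Di). Qed.

Lemma wt_sqr_off l : off s J l -> wt l ^+ 2 = dist l.
Proof. by move=> lo; rewrite wt_off // sqr_sqrtr // ltW // dist_gt0. Qed.

Lemma wt_bounded : bounded_symbol D wt.
Proof.
case: lam_bounded => C lamC; case/fset0Pn: J0 => k kJ.
exists (Num.sqrt (C + C) + Num.sqrt gam) => i Di.
rewrite ger0_norm ?(ltW (wt_gt0 Di)) // /wt; case: ifPn => [_|_].
  rewrite (le_trans _ (_ : Num.sqrt (C + C) <= _)) ?lerDl ?sqrtr_ge0 //.
  apply: ler_wsqrtr; rewrite (le_trans (dist_le _ kJ)) // (le_trans (ler_normB _ _)) //.
  by rewrite lerD ?lamC //; exact: JD.
by rewrite lerDr sqrtr_ge0.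
Qed.

Lemma inv_wt_bounded : bounded_symbol D (fun i => (wt i)^-1).
Proof.
exists (Num.sqrt gam)^-1 => i Di.
rewrite ger0_norm ?invr_ge0 ?(ltW (wt_gt0 Di)) // lef_pV2 ?posrE ?wt_gt0 //.
  exact: wt_ge.
exact: sqrt_gap_gt0.
Qed.

Definition Tinv : V -> V := dg wt.

Lemma off_symbol_bounded (f : nat + nat -> R) (C : R) : (forall l, off s J l -> `|f l| <= C) ->
  bounded_symbol D (fun i => if i \in off s J then f i else 0).
Proof.
move=> fC; exists `|C| => i Di; case: ifPn => [/set_mem lo|_]; last by rewrite normr0.
exact: le_trans (fC _ lo) (ler_norm _).
Qed.

Lemma absR_half_diagop x :
  absR_half ip s J x = dg (fun i => if i \in off s J then (wt i)^-1 else 0) x.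
Proof.
transitivity (dg (fun i => if i \in off s J then (Num.sqrt (dist i))^-1 else 0) x).
  exact: (series_over_diagop ip psi _ x off_used).
congr (diagop _ _ _ _ x); apply/funext => i.
by case: ifPn => // /set_mem lo; rewrite wt_off.
Qed.

Lemma inv_wt_off_bounded :
  bounded_symbol D (fun i => if i \in off s J then (wt i)^-1 else 0).
Proof.
case: inv_wt_bounded => C wC; apply: (@off_symbol_bounded _ C) => l lo.
exact: wC (off_used lo).
Qed.

Lemma absR_half_coord x i : D i -> ip (psi i) (absR_half ip s J x) =
  (if i \in off s J then (wt i)^-1 else 0) * ip (psi i) x.
Proof.
move=> Di; rewrite absR_half_diagop (diagop_coord ipN ob) //.
exact: inv_wt_off_bounded.
Qed.

Lemma T_half_diagop x H : self_adjoint ip H -> is_eigensystem ip H s ->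
  T_half ip s J x = dg (fun i => (wt i)^-1) x.
Proof.
move=> Hs es; apply: (coord_ext ob) => i Di.
rewrite (diagop_coord ipN ob) //; last exact: inv_wt_bounded.
rewrite /T_half ipDr ipZr absR_half_coord // (PJ_coord es) //.
case: (boolP (i \in off s J)) => io.
  by move/set_mem/offP: (io) => [_ ->]; rewrite mul0r mulr0 add0r.
have [k kJ ik] := onP Di (fun h => negP io (mem_set h)).
by rewrite mul0r addr0 mulrA /wt (negbTE io) ik /= kJ mulr1.
Qed.

(** The reduced resolvent of [H] at the eigenvalue of index [k]. *)
Definition res k i : R := if i \in off s J then (lam (inl k) - lam i)^-1 else 0.

Lemma res_bounded k : k \in J -> bounded_symbol D (res k).
Proof.
move=> kJ; apply: (@off_symbol_bounded _ gam^-1) => l lo.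
have h := gap_le kJ lo; rewrite normfV lef_pV2 ?posrE //.
exact: lt_le_trans h.
Qed.

Section FirstOrder.
Variable E : V -> V.
Hypothesis linE : linear E.
Hypothesis Eself : self_adjoint ip E.
#[local] Existing Instance summability.totally_filter.

(** First-order change of the [k]-th eigenvector in the directions outside [J]. *)
Definition first_order k : V := dg (res k) (E (psi (inl k))).

(** Each term of the double series has rank two, so the inner series is summed
    inside one fixed vector and one fixed linear form. *)
Lemma SJE x : SJ ip s J E x =
  \sum_(k <- J) (ip (first_order k) x *: psi (inl k)
                 + ip (psi (inl k)) x *: first_order k).
Proof.
rewrite /SJ big_seq [RHS]big_seq; apply: eq_bigr => k kJ.
have bk := res_bounded kJ.
pose u F := ip (E (psi (inl k))) (diag_sum ip D psi (res k) x F) *: psi (inl k)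
   + ip (psi (inl k)) x *: diag_sum ip D psi (res k) (E (psi (inl k))) F.
have uE : summability.partial_sum (patch (fun=> 0) (off s J) (fun l =>
    (lam (inl k) - lam l)^-1 *: (Qproj ip s (inl k) (E (Qproj ip s l x)) +
      Qproj ip s l (E (Qproj ip s (inl k) x))))) = u.
  apply/funext => F; rewrite /u !diag_sumE /summability.partial_sum.
  rewrite -(big_seq_fsetE _ F predT (patch (fun=> 0) (off s J) (fun l =>
    (lam (inl k) - lam l)^-1 *: (Qproj ip s (inl k) (E (Qproj ip s l x)) +
      Qproj ip s l (E (Qproj ip s (inl k) x)))))) /=.
  rewrite ip_sumr scaler_suml scaler_sumr -big_split /= [RHS]big_mkcond /=.
  apply: eq_bigr => i _; rewrite /patch /res.
  case: (boolP (i \in off s J)) => io; last first.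
    by rewrite !mul0r !scale0r ip0r scale0r scaler0 addr0 if_same.
  rewrite mem_set; last by apply: off_used; exact: set_mem.
  rewrite /Qproj /tensor !(linZ linE) !ipZr !scalerDr !scalerA Eself.
  by congr (_ *: _ + _ *: _); ring.
rewrite /series_over /summability.sum uE.
have -> : ip (first_order k) x = ip (E (psi (inl k))) (dg (res k) x).
  by rewrite /first_order (diagop_self_adjoint ipN ob).
apply: cvg_lim; first exact: norm_hausdorff.
apply: cvgD.
  by apply: cvgZ; [exact: (ip_diagop_cvg ipN ob)|exact: cvg_cst].
by apply: cvgZ; [exact: cvg_cst|exact: (diagop_cvg ipN ob)].
Qed.

End FirstOrder.
End Weights.

(** * Displacement of the eigenvalues *)

Section Perturbation.
Context {R : realType} {V : completeNormedModType R}.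
Variable ip : {dot V for @idfun R}.
Hypothesis ipN : norm_induced_by ip.
Variables (H Hhat : V -> V).
Hypothesis linH : linear H.
Hypothesis linHhat : linear Hhat.
Hypothesis Hself : self_adjoint ip H.
Hypothesis Hhatself : self_adjoint ip Hhat.
Variables (s shat : eigensystem V).
Hypothesis es : is_eigensystem ip H s.
Hypothesis eshat : is_eigensystem ip Hhat shat.
Variable J : {fset nat}.
Hypothesis J0 : J != fset0.
Hypothesis JD : used_block s J.
Hypothesis JDhat : used_block shat J.
Hypothesis gam0 : 0 < gap s J.

Local Notation D := (eigidx s).
Local Notation Dhat := (eigidx shat).
Local Notation lam := (eigval s).
Local Notation lamhat := (eigval shat).
Local Notation psi := (eigvec s).
Local Notation psihat := (eigvec shat).
Local Notation dg := (diagop ip D psi).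
Local Notation gam := (gap s J).
Local Notation P := (PJ ip s J).
Local Notation Phat := (PJ ip shat J).
Local Notation T := (T_half ip s J).
Local Notation Ti := (Tinv ip s J).
Local Notation wt := (wt s J).

Definition off_proj x := x - P x.
Definition off_projhat x := x - Phat x.
Definition perturbation x := Hhat x - H x.
Local Notation Q := off_proj.
Local Notation Qhat := off_projhat.
Local Notation E := perturbation.
Definition weighted_perturbation x := T (E (T x)).
Local Notation A := weighted_perturbation.

Variable a : R.
Hypothesis a0 : 0 <= a.
Hypothesis Abound : opbound A a.

Let ob := eigsys_basis es.
Let obhat := eigsys_basis eshat.
Let lamb := eigval_bounded es.
Let wtb : bounded_symbol D wt := wt_bounded lamb JD J0 gam0.
Let iwtb : bounded_symbol D (fun i => (wt i)^-1) := inv_wt_bounded J0 gam0.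

Lemma linE : linear E.
Proof. by move=> c x y; rewrite /E linHhat linH scalerBr opprD addrACA. Qed.

Lemma Eself : self_adjoint ip E.
Proof. by move=> x y; rewrite /E ipBl ipBr Hself Hhatself. Qed.

Lemma T_diagop x : T x = dg (fun i => (wt i)^-1) x.
Proof. by rewrite (T_half_diagop ipN ob JD J0 gam0 _ Hself). Qed.

Lemma Tself : self_adjoint ip T.
Proof. by move=> x y; rewrite !T_diagop (diagop_self_adjoint ipN ob). Qed.

Lemma Tinv_coord x i : D i -> ip (psi i) (Ti x) = wt i * ip (psi i) x.
Proof. by move=> Di; rewrite (diagop_coord ipN ob). Qed.

Lemma Tinv_self : self_adjoint ip Ti.
Proof. exact: (diagop_self_adjoint ipN ob). Qed.

Lemma linTinv : linear Ti.
Proof. exact: (diagop_lin ipN ob). Qed.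

Lemma T_coord x i : D i -> ip (psi i) (T x) = (wt i)^-1 * ip (psi i) x.
Proof. by move=> Di; rewrite T_diagop (diagop_coord ipN ob). Qed.

Lemma T_Tinv x : T (Ti x) = x.
Proof.
apply: (coord_ext ob) => i Di; rewrite T_coord // Tinv_coord // mulrA mulVf ?mul1r //.
by rewrite gt_eqF // (wt_gt0 J0).
Qed.

Lemma Tinv_T x : Ti (T x) = x.
Proof.
apply: (coord_ext ob) => i Di; rewrite Tinv_coord // T_coord // mulrA mulfV ?mul1r //.
by rewrite gt_eqF // (wt_gt0 J0).
Qed.

Lemma E_factor x : E x = Ti (A (Ti x)).
Proof. by rewrite /A T_Tinv Tinv_T. Qed.

Lemma linA : linear A.
Proof.
move=> c x y; rewrite /A !T_diagop !(diagop_lin ipN ob iwtb) linE.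
by rewrite (diagop_lin ipN ob iwtb).
Qed.

Lemma Aself : self_adjoint ip A.
Proof. by move=> x y; rewrite /A Tself Eself Tself. Qed.

Lemma form_E_le x : `|ip x (E x)| <= a * `|Ti x| ^+ 2.
Proof.
rewrite E_factor -Tinv_self (le_trans (cauchy_schwarz_norm ipN _ _)) //.
by rewrite mulrC expr2 mulrA ler_wpM2r.
Qed.

(** Symbols of [H + a Tinv^2] and [H - a Tinv^2], which enclose [Hhat] in the
    sense of quadratic forms. *)
Definition upper_symbol i : R := lam i + a * wt i ^+ 2.
Definition lower_symbol i : R := lam i - a * wt i ^+ 2.

Lemma wt_sqr_bounded : bounded_symbol D (fun i => wt i ^+ 2).
Proof.
case: wtb => C wC; exists (C ^+ 2) => i Di.
by rewrite normrX ler_pXn2r ?nnegrE ?wC //; exact: le_trans (wC _ Di).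
Qed.

Lemma shifted_symbol_bounded (c : R) : bounded_symbol D (fun i => lam i + c * wt i ^+ 2).
Proof.
case: wt_sqr_bounded => C wC; case: lamb => C' lC.
exists (C' + `|c| * C) => i Di; rewrite (le_trans (ler_normD _ _)) // lerD ?lC //.
by rewrite normrM ler_wpM2l // wC.
Qed.

Lemma form_shift c x :
  ip x (dg (fun i => lam i + c * wt i ^+ 2) x) = ip x (H x) + c * `|Ti x| ^+ 2.
Proof.
have -> : dg (fun i => lam i + c * wt i ^+ 2) x = H x + c *: Ti (Ti x).
  apply: (coord_ext ob) => i Di; rewrite ipDr ipZr (eigval_coord Hself es) //.
  rewrite !Tinv_coord // (diagop_coord ipN ob) //; first by ring.
  exact: shifted_symbol_bounded.
by rewrite ipDr ipZr -Tinv_self ipN.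
Qed.

Lemma form_Hhat_le x : ip x (Hhat x) <= ip x (dg upper_symbol x).
Proof.
rewrite form_shift; have := form_E_le x; rewrite ler_norml => /andP[_].
by rewrite /E ipBr; lra.
Qed.

Lemma form_Hhat_ge x : ip x (dg lower_symbol x) <= ip x (Hhat x).
Proof.
have -> : dg lower_symbol x = dg (fun i => lam i + - a * wt i ^+ 2) x.
  by congr (diagop _ _ _ _ x); apply/funext => i; rewrite mulNr.
rewrite form_shift; have := form_E_le x; rewrite ler_norml => /andP[+ _].
by rewrite /E ipBr; lra.
Qed.

Lemma const_bounded (I : choiceType) (D' : set I) (c : R) : bounded_symbol D' (fun=> c).
Proof. by exists `|c|. Qed.

Lemma form_const (s' : eigensystem V) c x :
  orthonormal_basis ip (eigidx s') (eigvec s') ->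
  ip x (diagop ip (eigidx s') (eigvec s') (fun=> c) x) = c * `|x| ^+ 2.
Proof.
move=> ob'.
have -> : diagop ip (eigidx s') (eigvec s') (fun=> c) x = c *: x.
  apply: (coord_ext ob') => i Di; rewrite (diagop_coord ipN ob') ?ipZr //.
  exact: const_bounded.
by rewrite ipZr ipN.
Qed.

Lemma sqnorm_gt0 (x : V) : x != 0 -> 0 < `|x| ^+ 2.
Proof. by move=> x0; rewrite exprn_gt0 // normr_gt0. Qed.

(** Relative Weyl inequality: in the min-max characterization of the [k]-th
    eigenvalue the perturbation at [l] outside [J] costs at most
    [a * dist l <= dist l], which is absorbed by the distance from [lam l] to
    [lam k]; only the indices in [J] contribute, with [a * gap]. *)
Lemma eigval_perturbation k : a <= 1 -> k \in J ->
  `|lamhat (inl k) - lam (inl k)| <= a * gam.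
Proof.
move=> a1 kJ; have Dk := JD kJ; have Dhk := JDhat kJ.
have [_ _ mono pos ker] := es; have [_ _ monoh posh kerh] := eshat.
have agam : 0 <= a * gam by rewrite mulr_ge0 // ltW.
have finj : injective (fun j : 'I_k.+1 => inl (val j) : nat + nat).
  by move=> i j [] /val_inj.
rewrite ler_norml; apply/andP; split.
- have [|x [x0 xg xf]] := @minmax_vector _ _ _ _ _ _ k _
    (fun m : 'I_k => psihat (inl (val m))) ob finj.
    by move=> j; apply: (proj1 (mono _ _ _ Dk)); rewrite -ltnS ltn_ord.
  suff : (lam (inl k) - a * gam) * `|x| ^+ 2 <= lamhat (inl k) * `|x| ^+ 2.
    by rewrite ler_pM2r ?sqnorm_gt0 //; lra.
  rewrite -(form_const _ _ ob) -(form_const _ _ obhat).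
  apply: (@le_trans _ _ (ip x (dg lower_symbol x))).
    apply: (diagop_form_le ipN ob); first exact: const_bounded.
      have := shifted_symbol_bounded (- a); congr bounded_symbol.
      by apply/funext => i; rewrite mulNr.
    move=> i Di /(xf _ Di) [j ij]; rewrite /lower_symbol.
    have jk : (val j <= k)%N by rewrite -ltnS ltn_ord.
    have le_lam : lam (inl k) <= lam i by rewrite ij; apply: (proj2 (mono _ _ jk Dk)).
    have [io|/(onP Di) [m mJ im]] := pselect (off s J i).
      rewrite (wt_sqr_off J0) //; have := dist_le s i kJ.
      have := dist_gt0 J0 gam0 io.
      by rewrite ger0_norm ?subr_ge0 //; nra.
    rewrite im /= wt_on /= ?mJ ?oner_eq0 // sqr_sqrtr ?(ltW gam0) // -im; lra.
  apply: le_trans (form_Hhat_ge x) _; rewrite (eig_diagop ipN Hhatself eshat).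
  apply: (diagop_form_le ipN obhat); first exact: (eigval_bounded eshat).
    exact: const_bounded.
  move=> [m|j] Di; last by rewrite kerh // posh.
  have [mk|km] := ltnP m k; first by rewrite (xg (Ordinal mk)) eqxx.
  by move=> _; apply: (proj2 (monoh _ _ km Di)).
- have [|x [x0 xg xf]] := @minmax_vector _ _ _ _ _ _ k _
    (fun m : 'I_k => psi (inl (val m))) obhat finj.
    by move=> j; apply: (proj1 (monoh _ _ _ Dhk)); rewrite -ltnS ltn_ord.
  suff : lamhat (inl k) * `|x| ^+ 2 <= (lam (inl k) + a * gam) * `|x| ^+ 2.
    by rewrite ler_pM2r ?sqnorm_gt0 //; lra.
  rewrite -(form_const _ _ obhat) -(form_const _ _ ob).
  apply: (@le_trans _ _ (ip x (Hhat x))).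
    rewrite (eig_diagop ipN Hhatself eshat); apply: (diagop_form_le ipN obhat).
    + exact: const_bounded.
    + exact: (eigval_bounded eshat).
    move=> i Di /(xf _ Di) [j ij]; rewrite ij.
    by apply: (proj2 (monoh _ _ _ Dhk)); rewrite -ltnS ltn_ord.
  apply: le_trans (form_Hhat_le x) _; apply: (diagop_form_le ipN ob).
  + exact: shifted_symbol_bounded.
  + exact: const_bounded.
  move=> i Di xi0; rewrite /upper_symbol.
  have le_lam : lam i <= lam (inl k).
    case: i Di xi0 => [m|j] Di xi0; last by rewrite ker // pos.
    have [mk|km] := ltnP m k; first by rewrite (xg (Ordinal mk)) eqxx in xi0.
    by apply: (proj2 (mono _ _ km Di)).
  have [io|/(onP Di) [m mJ im]] := pselect (off s J i).
    rewrite (wt_sqr_off J0) //; have := dist_le s i kJ; have := dist_gt0 J0 gam0 io.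
    by rewrite distrC ger0_norm ?subr_ge0 //; nra.
  rewrite im /= wt_on /= ?mJ ?oner_eq0 // sqr_sqrtr ?(ltW gam0) // -im; lra.
Qed.

(** * Resolvent bounds on one interval of eigenvalues *)

Lemma Q_off i x : off s J i -> ip (psi i) (Q x) = ip (psi i) x.
Proof.
move=> io; rewrite /Q ipBr (PJ_coord es) //; last exact: off_used io.
by case/offP: io => _ ->; rewrite mul0r subr0.
Qed.

Lemma Q_on i x : D i -> ~ off s J i -> ip (psi i) (Q x) = 0.
Proof.
move=> Di /(onP Di) [k kJ ik]; rewrite /Q ipBr (PJ_coord es) //.
by rewrite ik /= kJ mul1r subrr.
Qed.

Lemma dg_off_Q f x : bounded_symbol D f ->
  (forall i, ~ off s J i -> f i = 0) -> dg f (Q x) = dg f x.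
Proof.
move=> bf f0; apply: (coord_ext ob) => i Di; rewrite !(diagop_coord ipN ob) //.
by have [io|io] := pselect (off s J i); [rewrite Q_off | rewrite f0 // !mul0r].
Qed.

Lemma Q_norm x : `|Q x| <= `|x|.
Proof. exact: (PJC_norm ipN es). Qed.

Lemma linQ : linear Q.
Proof. by move=> c x y; rewrite /Q (PJ_lin es) // scalerBr opprD addrACA. Qed.

Lemma QP0 x : P x = x -> Q x = 0.
Proof. by rewrite /Q => ->; rewrite subrr. Qed.

Lemma Tinv_on x : P x = x -> Ti x = Num.sqrt gam *: x.
Proof.
move=> Px; apply: (coord_ext ob) => i Di; rewrite Tinv_coord // ipZr.
have [io|io] := pselect (off s J i).
  by rewrite -Px (PJ_coord es) //; case/offP: io => _ ->; rewrite mul0r !mulr0.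
by have [k kJ ->] := onP Di io; rewrite wt_on //= kJ oner_eq0.
Qed.

Lemma Tinv_split x : Ti x = Num.sqrt gam *: P x + Ti (Q x).
Proof.
by rewrite -Tinv_on ?(PJ_idem es) // -(linD linTinv) /Q addrC subrK.
Qed.

Lemma P_Tinv_Q x : P (Ti (Q x)) = 0.
Proof.
apply: (coord_ext ob) => i Di; rewrite (PJ_coord es) // ip0r Tinv_coord //.
have [io|io] := pselect (off s J i); last by rewrite Q_on // !mulr0.
by case/offP: io => _ ->; rewrite mul0r.
Qed.

Lemma Tinv_pythagoras x :
  `|Ti x| ^+ 2 = gam * `|P x| ^+ 2 + `|Ti (Q x)| ^+ 2.
Proof.
rewrite Tinv_split (pythagoras ipN).
  by rewrite normrZ exprMn real_normK ?num_real // sqr_sqrtr // ltW.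
rewrite ipZl; have -> : ip (P x) (Ti (Q x)) = 0.
  by rewrite (PJ_self_adjoint ipN es) // P_Tinv_Q ip0r.
by rewrite mulr0.
Qed.

Lemma Tinv_norm_le x : `|Ti x| <= Num.sqrt gam * `|P x| + `|Ti (Q x)|.
Proof.
rewrite Tinv_split (le_trans (ler_normD _ _)) // normrZ ger0_norm ?sqrtr_ge0 //.
Qed.

(** Symbol of the resolvent of the part of [H] outside [J]. *)
Definition shres c i : R := if i \in off s J then (lam i - c)^-1 else 0.

Lemma shres_out c i : ~ off s J i -> shres c i = 0.
Proof. by move=> io; rewrite /shres memNset. Qed.

Lemma symbolM_bounded (I : choiceType) (D' : set I) (f g : I -> R) :
  bounded_symbol D' f -> bounded_symbol D' g ->
  bounded_symbol D' (fun i => f i * g i).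
Proof.
by move=> [C fC] [C' gC]; exists (C * C') => i Di; rewrite normrM ler_pM ?fC ?gC.
Qed.

(** Coordinatewise form of [(H - c) x = (Hhat - c) x - E x] off [J]. *)
Lemma Q_resolvent c x : bounded_symbol D (shres c) ->
  (forall l, off s J l -> lam l != c) ->
  Q x = dg (shres c) (Q (Hhat x - c *: x))
        - dg (fun i => shres c i * wt i) (A (Ti x)).
Proof.
move=> bc lc; have bcw := symbolM_bounded bc wtb.
rewrite dg_off_Q //; last exact: shres_out.
apply: (coord_ext ob) => i Di; rewrite [RHS]ipBr !(diagop_coord ipN ob) //.
have [io|io] := pselect (off s J i); last by rewrite Q_on // shres_out // !mul0r subrr.
rewrite Q_off // /shres mem_set //.
have -> : Hhat x = H x + Ti (A (Ti x)) by rewrite -E_factor /E addrC subrK.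
rewrite ipBr ipDr ipZr Tinv_coord // (eigval_coord Hself es) //.
by field; rewrite subr_eq0 lc.
Qed.

Lemma TinvQ_resolvent c x : bounded_symbol D (shres c) ->
  (forall l, off s J l -> lam l != c) ->
  Ti (Q x) = dg (fun i => shres c i * wt i) (Q (Hhat x - c *: x))
             - dg (fun i => shres c i * wt i ^+ 2) (A (Ti x)).
Proof.
move=> bc lc; have bcw := symbolM_bounded bc wtb.
have bcw2 := symbolM_bounded bc wt_sqr_bounded.
rewrite [in LHS](Q_resolvent _ bc lc) (linB linTinv).
congr (_ - _); apply: (coord_ext ob) => i Di; rewrite Tinv_coord // !(diagop_coord ipN ob) //.
  by rewrite mulrA (mulrC (wt i)).
by rewrite mulrA; congr (_ * _); ring.
Qed.

(** The bound [r <= gap] ensures that the weight [wt l] grows more slowly than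
    [r + dist l], so that [shres_wt_le] is governed by the eigenvalues closest
    to [J]. *)
Definition interval_block (K : {fset nat}) (c r : R) :=
  [/\ {subset K <= J}, forall k, k \in K -> `|lam (inl k) - c| <= r,
      forall l, off s J l -> r + dist s J l <= `|lam l - c|, 0 <= r & r <= gam].

Section Block.
Variables (K : {fset nat}) (c r : R).
Hypothesis Kcr : interval_block K c r.

Let lc l : off s J l -> lam l != c.
Proof.
move=> lo; case: Kcr => _ _ /(_ l lo) + r0 _; have d0 := dist_gt0 J0 gam0 lo.
move=> h; apply/eqP => lc; move: h; rewrite lc subrr normr0; lra.
Qed.

Let rg : 0 < r + gam.
Proof. by case: Kcr => _ _ _ r0 _; exact: ltr_wpDl. Qed.

Lemma shres_le i : D i -> `|shres c i| <= (r + gam)^-1.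
Proof.
move=> Di; rewrite /shres; case: ifPn => [/set_mem lo|_]; last first.
  by rewrite normr0 invr_ge0 ltW.
case: Kcr => _ _ /(_ i lo) h r0 _.
have h2 := le_trans (lerD (lexx r) (gap_le_dist J0 lo)) h.
by rewrite normfV lef_pV2 // posrE; exact: lt_le_trans h2.
Qed.

Lemma shres_bounded : bounded_symbol D (shres c).
Proof. by exists (r + gam)^-1 => i; exact: shres_le. Qed.

Lemma shres_wt2_le i : D i -> `|shres c i * wt i ^+ 2| <= 1.
Proof.
move=> Di; rewrite /shres; case: ifPn => [/set_mem lo|_]; last first.
  by rewrite mul0r normr0.
case: Kcr => _ _ /(_ i lo) h r0 _; have d0 := dist_gt0 J0 gam0 lo.
rewrite normrM normfV (wt_sqr_off J0) // (gtr0_norm d0).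
have h3 : 0 < `|lam i - c| by apply: lt_le_trans h; exact: ltr_wpDl.
by rewrite ler_pdivrMl // mulr1; apply: le_trans h; rewrite lerDr.
Qed.

(** [d^(1/2) / (r + d)] decreases for [d >= gap] because [r <= gap]. *)
Lemma shres_wt_le i : D i -> `|shres c i * wt i| <= Num.sqrt gam / (r + gam).
Proof.
move=> Di; rewrite /shres; case: ifPn => [/set_mem lo|_]; last first.
  by rewrite mul0r normr0 divr_ge0 ?sqrtr_ge0 // ltW.
case: Kcr => _ _ /(_ i lo) h r0 rle; have d0 := dist_gt0 J0 gam0 lo.
have h3 : 0 < `|lam i - c| by apply: lt_le_trans h; exact: ltr_wpDl.
have w0 := wt_gt0 J0 gam0 Di; have gw := wt_ge J0 Di.
rewrite normrM normfV (gtr0_norm w0) mulrC.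
rewrite ler_pdivrMr // mulrAC ler_pdivlMr //.
have g0 := sqrt_gap_gt0 gam0.
have gg : Num.sqrt gam ^+ 2 = gam by rewrite sqr_sqrtr // ltW.
have ww := wt_sqr_off J0 gam0 lo.
apply: (@le_trans _ _ (Num.sqrt gam * (r + dist s J i))); last by rewrite ler_wpM2l // ltW.
rewrite -subr_ge0 -ww; move: g0 gg gw; move: (Num.sqrt gam) => g g0 gg gw.
move: rle; rewrite -gg => rle.
have -> : g * (r + wt i ^+ 2) - wt i * (r + g ^+ 2) =
  (wt i - g) * (wt i * g - r) by ring.
apply: mulr_ge0; first by rewrite subr_ge0.
by rewrite subr_ge0 (le_trans rle) // expr2 ler_wpM2r // ltW.
Qed.

Let X x := PJ ip shat K x = x.

Let Kused : used_block shat K.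
Proof. by case: Kcr => KJ _ _ _ _ k /KJ; exact: JDhat. Qed.

Let X_stable x : X x -> X (Hhat x - c *: x).
Proof. exact: (block_shift_stable Hhatself eshat _ Kused linHhat). Qed.

Let X_shift x : a <= 1 -> X x -> `|Hhat x - c *: x| <= (r + a * gam) * `|x|.
Proof.
move=> a1; apply: (block_shift_norm ipN Hhatself eshat) => // [k kK|]; last first.
  by case: Kcr => _ _ _ r0 _; rewrite addr_ge0 // mulr_ge0 // ltW.
case: Kcr => KJ lamc _ _ _.
rewrite -(subrKA (lam (inl k))) addrC (le_trans (ler_normD _ _)) //.
by rewrite lerD ?lamc // eigval_perturbation // KJ.
Qed.

(** First contraction: on the range of the perturbed block the resolvent
    identity bounds [Q] by itself with factor [(r + a gam) / (r + gam)]. *)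
Lemma block_Q_le phi : a <= 1 / 4 -> 0 <= phi ->
  (forall x, X x -> `|A (Ti x)| <= phi * `|x|) ->
  forall x, X x -> `|Q x| <= phi / (Num.sqrt gam * (1 - a)) * `|x|.
Proof.
move=> a4 phi0 Aphi.
have a1 : a <= 1 by lra.
have [KJ lamc lamo r0 rle] := Kcr.
have g0 := sqrt_gap_gt0 gam0.
have gg : Num.sqrt gam ^+ 2 = gam by rewrite sqr_sqrtr // ltW.
have ag : 0 <= a * gam by rewrite mulr_ge0 // ltW.
have lim := @contraction_bound _ _ X (fun x => `|Q x|) 1
  ((r + a * gam) / (r + gam)) (Num.sqrt gam * phi / (r + gam)).
have e : Num.sqrt gam * phi / (r + gam) / (1 - (r + a * gam) / (r + gam)) =
    phi / (Num.sqrt gam * (1 - a)).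
  move: g0 gg rg gam0; move: (Num.sqrt gam) => g g0 <- rg' g20; field.
  have -> : r + g ^+ 2 - (r + a * g ^+ 2) = (1 - a) * g ^+ 2 by ring.
  by rewrite !mulf_neq0 ?(gt_eqF g0) ?(gt_eqF rg') ?(gt_eqF g20) ?andbT ?gt_eqF //; lra.
rewrite e in lim; apply: lim.
- by rewrite divr_ge0 ?addr_ge0 // ltW.
- by rewrite ltr_pdivrMr // mul1r ltrD2l; nra.
- by rewrite divr_ge0 ?mulr_ge0 // ltW.
- by move=> x _; rewrite mul1r Q_norm.
move=> C C0 QC x Xx.
rewrite (Q_resolvent _ shres_bounded) //.
rewrite (le_trans (ler_normB _ _)) //.
have h1 := diagop_le ipN ob (Q (Hhat x - c *: x)) shres_le.
have h2 := diagop_le ipN ob (A (Ti x)) shres_wt_le.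
have h3 := QC _ (X_stable Xx); have h4 := X_shift a1 Xx; have h5 := Aphi _ Xx.
rewrite (le_trans (lerD h1 h2)) // mulrDl; apply: lerD.
  have -> : (r + a * gam) / (r + gam) * C * `|x| =
    (r + gam)^-1 * (C * ((r + a * gam) * `|x|)) by ring.
  by rewrite ler_wpM2l ?invr_ge0 ?(ltW rg) // (le_trans h3) // ler_wpM2l.
have -> : Num.sqrt gam * phi / (r + gam) * `|x| =
  Num.sqrt gam / (r + gam) * (phi * `|x|) by ring.
by rewrite ler_wpM2l // divr_ge0 // ltW.
Qed.

Let Px_le x : `|P x| <= `|x|.
Proof. exact: (PJ_norm ipN es). Qed.

Let ATi_le (w : R) x : `|Ti (Q x)| <= w * `|x| ->
  `|A (Ti x)| <= a * (Num.sqrt gam + w) * `|x|.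
Proof.
move=> wx; rewrite (le_trans (Abound _)) // -mulrA ler_wpM2l //.
rewrite (le_trans (Tinv_norm_le _)) // mulrDl lerD //.
by rewrite ler_wpM2l ?sqrtr_ge0.
Qed.

Let denom_gt0 : a <= 1 / 4 -> 0 < 2 - 5 * a + a ^+ 2.
Proof. by move=> a4; have := sqr_ge0 a; lra. Qed.

(** Second contraction: the weighted norm is controlled by the source term
    [A (Ti x)], which the first contraction and the smallness of [a] let one
    bound by the weighted norm itself. *)
Lemma block_TinvQ_le : a <= 1 / 4 -> forall x, X x ->
  `|Ti (Q x)| <= a * (3 - a) / (2 - 5 * a + a ^+ 2) * Num.sqrt gam * `|x|.
Proof.
move=> a4.
have [KJ lamc lamo r0 rle] := Kcr.
have a1 : a <= 1 by lra.
have d0 := denom_gt0 a4.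
have g0 := sqrt_gap_gt0 gam0.
have [Cw wC] := wtb.
have Cw0 : 0 <= Cw.
  by case/fset0Pn: J0 => k /JD Dk; exact: le_trans (wC _ Dk).
have nd : 2 - 5 * a + a ^+ 2 != 0 by rewrite gt_eqF.
have na : 1 - a != 0 by rewrite gt_eqF //; lra.
have ng : Num.sqrt gam != 0 by rewrite gt_eqF.
have nr : r + gam != 0 by rewrite gt_eqF.
pose kap := (3 - a) / (2 * (1 - a)).
have lim := @contraction_bound _ _ X (fun x => `|Ti (Q x)|) Cw
  (kap * a) (kap * a * Num.sqrt gam).
have e : kap * a * Num.sqrt gam / (1 - kap * a) =
    a * (3 - a) / (2 - 5 * a + a ^+ 2) * Num.sqrt gam.
  rewrite /kap; field.
  by rewrite nd na.
have kap0 : 0 <= kap by rewrite /kap divr_ge0 //; lra.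
have kap1 : kap * a < 1.
  rewrite /kap mulrAC ltr_pdivrMr; last by lra.
  by have := sqr_ge0 a; nra.
rewrite e in lim; apply: lim => //.
- exact: mulr_ge0.
- exact: mulr_ge0 (mulr_ge0 kap0 a0) (ltW g0).
- by move=> x _; rewrite (le_trans (diagop_le ipN ob _ wC)) // ler_wpM2l ?Q_norm.
move=> C C0 TQC x Xx.
pose phi := a * (Num.sqrt gam + C).
have phi0 : 0 <= phi by rewrite mulr_ge0 // addr_ge0 // ltW.
have Aphi y : X y -> `|A (Ti y)| <= phi * `|y| by move=> Xy; apply: ATi_le; exact: TQC.
have Qz := block_Q_le a4 phi0 Aphi (X_stable Xx).
have z_le := X_shift a1 Xx.
rewrite (TinvQ_resolvent _ shres_bounded) // (le_trans (ler_normB _ _)) //.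
have h1 := diagop_le ipN ob (Q (Hhat x - c *: x)) shres_wt_le.
have h2 := diagop_le ipN ob (A (Ti x)) shres_wt2_le.
rewrite (le_trans (lerD h1 h2)) // mul1r.
have -> : kap * a * C + kap * a * Num.sqrt gam = kap * phi by rewrite /phi; ring.
have q0 : 0 <= phi / (Num.sqrt gam * (1 - a)).
  by rewrite divr_ge0 // mulr_ge0 ?(ltW g0) //; lra.
have h3 := le_trans Qz (ler_wpM2l q0 z_le).
have w0 : 0 <= Num.sqrt gam / (r + gam) by rewrite divr_ge0 // ltW.
apply: le_trans (lerD (ler_wpM2l w0 h3) (Aphi _ Xx)) _.
have -> : Num.sqrt gam / (r + gam) * (phi / (Num.sqrt gam * (1 - a)) *
   ((r + a * gam) * `|x|)) + phi * `|x| =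
   ((r + a * gam) / (r + gam) / (1 - a) + 1) * (phi * `|x|).
  by field; rewrite na ng nr.
rewrite -[leRHS]mulrA ler_wpM2r ?(mulr_ge0 phi0) //.
have half : (r + a * gam) / (r + gam) <= (1 + a) / 2.
  by rewrite ler_pdivrMr // -subr_ge0; nra.
have -> : kap = (1 + a) / 2 / (1 - a) + 1 by rewrite /kap; field; rewrite na.
by rewrite lerD2r ler_wpM2r // invr_ge0; lra.
Qed.

Lemma block_Q_bound : a <= 1 / 4 -> forall x, X x ->
  `|Q x| <= 2 * a / (2 - 5 * a + a ^+ 2) * `|x|.
Proof.
move=> a4 x Xx; have d0 := denom_gt0 a4; have g0 := sqrt_gap_gt0 gam0.
have nd : 2 - 5 * a + a ^+ 2 != 0 by rewrite gt_eqF.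
have na : 1 - a != 0 by rewrite gt_eqF //; lra.
have ng : Num.sqrt gam != 0 by rewrite gt_eqF.
pose w := a * (3 - a) / (2 - 5 * a + a ^+ 2) * Num.sqrt gam.
have w0 : 0 <= w by rewrite /w !(divr_ge0, mulr_ge0) ?(ltW d0) ?(ltW g0) //; lra.
have Aphi y : X y -> `|A (Ti y)| <= a * (Num.sqrt gam + w) * `|y|.
  by move=> Xy; apply: ATi_le; exact: block_TinvQ_le.
have phi0 : 0 <= a * (Num.sqrt gam + w) by rewrite mulr_ge0 // addr_ge0 // ltW.
have := block_Q_le a4 phi0 Aphi Xx; congr (_ <= _ * _).
by rewrite /w; field; rewrite nd na ng.
Qed.

(** * The remainder and its Sylvester equation *)

(** The Sylvester equation [H B - B H = g] from a block to the complement of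
    [J]: after shifting by [c], [B] is bounded by itself with factor
    [r / (r + gap)]. *)
Lemma block_sylvester (B g : V -> V) (C0 nu : R) :
  linear B ->
  (forall y, P y = y -> forall l, off s J l ->
     lam l * ip (psi l) (B y) = ip (psi l) (B (H y)) + ip (psi l) (g y)) ->
  (forall y i, D i -> ~ off s J i -> ip (psi i) (B y) = 0) ->
  opbound B C0 -> 0 <= nu ->
  (forall y, P y = y -> `|dg (shres c) (g y)| <= nu / (r + gam) * `|y|) ->
  forall y, PJ ip s K y = y -> `|B y| <= nu / gam * `|y|.
Proof.
move=> Blin Bg Bon BC0 nu0 gnu.
have [KJ lamc lamo r0 rle] := Kcr.
have KD : used_block s K by move=> k /KJ; exact: JD.
have nr : r + gam != 0 by rewrite gt_eqF.
have lim := @contraction_bound _ _ (fun y => PJ ip s K y = y) (fun y => `|B y|) C0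
  (r / (r + gam)) (nu / (r + gam)).
have e : nu / (r + gam) / (1 - r / (r + gam)) = nu / gam.
  by field; rewrite nr gt_eqF.
rewrite e in lim; apply: lim.
- by rewrite divr_ge0 // ltW.
- by rewrite ltr_pdivrMr // mul1r ltrDl.
- by rewrite divr_ge0 // ltW.
- by move=> y _; exact: BC0.
move=> C CC BC y Ky.
have Py : P y = y by rewrite -Ky (PJ_sub es).
pose z := H y - c *: y.
have zK : PJ ip s K z = z by exact: (block_shift_stable Hself es _ KD linH).
have z_le : `|z| <= r * `|y| by apply: (block_shift_norm ipN Hself es KD).
have -> : B y = dg (shres c) (B z) + dg (shres c) (g y).
  have bs := shres_bounded.
  apply: (coord_ext ob) => i Di; rewrite [RHS]ipDr !(diagop_coord ipN ob) //.
  have [io|io] := pselect (off s J i); last by rewrite Bon // shres_out // !mul0r addr0.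
  rewrite /shres mem_set // /z (linB Blin) (linZ Blin) ipBr ipZr.
  rewrite -[ip _ (B (H y))](addrK (ip (psi i) (g y))) -Bg //.
  by field; rewrite subr_eq0 lc.
rewrite (le_trans (ler_normD _ _)) // mulrDl lerD ?gnu //.
apply: le_trans (diagop_le ipN ob _ shres_le) _.
have -> : r / (r + gam) * C * `|y| = (r + gam)^-1 * (C * (r * `|y|)) by ring.
by rewrite ler_wpM2l ?invr_ge0 ?(ltW rg) // (le_trans (BC _ zK)) // ler_wpM2l.
Qed.

Lemma shres_E x :
  dg (shres c) (E x) = dg (fun i => shres c i * wt i) (A (Ti x)).
Proof.
have bs := shres_bounded; have bsw := symbolM_bounded bs wtb.
rewrite E_factor; apply: (coord_ext ob) => i Di; rewrite !(diagop_coord ipN ob) //.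
by rewrite mulrA.
Qed.

Lemma shres_E_le x :
  `|dg (shres c) (E x)| <= Num.sqrt gam / (r + gam) * (a * `|Ti x|).
Proof.
rewrite shres_E (le_trans (diagop_le ipN ob _ shres_wt_le)) // ler_wpM2l ?Abound //.
by rewrite divr_ge0 ?sqrtr_ge0 // ltW.
Qed.

End Block.

Local Notation S := (SJ ip s J E).
Local Notation v := (first_order ip s J E).

Definition remainder x := Phat x - P x - S x.
Local Notation err := remainder.

Let SE x := SJE ipN ob gam0 linE Eself x.

Lemma linS : linear S.
Proof.
move=> t x y; rewrite !SE scaler_sumr -big_split /=; apply: eq_bigr => k _.
by rewrite !ipDr !ipZr !scalerDr !scalerDl !scalerA addrACA.
Qed.

Lemma Sself : self_adjoint ip S.
Proof.
move=> x y; rewrite !SE ip_suml ip_sumr; apply: eq_bigr => k _.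
by rewrite !ipDl !ipDr !ipZl !ipZr !(ipC _ x); ring.
Qed.

Lemma v_coord k i : k \in J -> D i ->
  ip (psi i) (v k) = res s J k i * ip (psi i) (E (psi (inl k))).
Proof. by move=> kJ Di; rewrite (diagop_coord ipN ob) //; exact: res_bounded. Qed.

Lemma P_v k : k \in J -> P (v k) = 0.
Proof.
move=> kJ; apply: (coord_ext ob) => i Di; rewrite (PJ_coord es) // ip0r v_coord //.
rewrite /res; case: ifPn => [/set_mem/offP[_ ->]|_]; by rewrite ?mul0r ?mulr0.
Qed.

Lemma P_psi k : k \in J -> P (psi (inl k)) = psi (inl k).
Proof. exact: (PJ_basis es). Qed.

Lemma P_self : self_adjoint ip P.
Proof. exact: (PJ_self_adjoint ipN es). Qed.

Lemma P_S_P x : P (S (P x)) = 0.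
Proof.
rewrite SE (lin_sum (PJ_lin es JD)) big_seq big1 // => k kJ.
rewrite (linD (PJ_lin es JD)) !(linZ (PJ_lin es JD)) P_v // scaler0 addr0.
by rewrite -P_self P_v // ip0l scale0r.
Qed.

Lemma Q_S_Q x : Q (S (Q x)) = 0.
Proof.
rewrite SE (lin_sum linQ) big_seq big1 // => k kJ.
rewrite (linD linQ) !(linZ linQ) (QP0 (P_psi kJ)) scaler0 add0r.
have -> : ip (psi (inl k)) (Q x) = 0.
  by rewrite -(P_psi kJ) (PJ_orth ipN es).
by rewrite scale0r.
Qed.

Lemma S_sylvester y : P y = y -> forall l, off s J l ->
  lam l * ip (psi l) (S y) = ip (psi l) (S (H y)) + ip (psi l) (- E y).
Proof.
move=> Py l lo; have Dl := off_used lo.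
have psi0 k : k \in J -> ip (psi l) (psi (inl k)) = 0.
  move=> kJ; rewrite (ip_basis ob) //; last exact: JD.
  by case: eqP => // lk; case/offP: lo => _ /eqP; rewrite lk /= kJ oner_eq0.
have Ey : E y = \sum_(k <- J) ip (psi (inl k)) y *: E (psi (inl k)).
  by rewrite -{1}Py /PJ (lin_sum linE); apply: eq_bigr => k _; rewrite (linZ linE).
rewrite ipNr Ey !SE !ip_sumr mulr_sumr -sumrB big_seq [RHS]big_seq.
apply: eq_bigr => k kJ; rewrite !ipDr !ipZr psi0 // v_coord //.
rewrite (eigval_coord Hself es) //; last exact: JD.
rewrite /res mem_set //; field; rewrite subr_eq0.
have := gap_le kJ lo; apply: contraTneq => ->.
by rewrite subrr normr0 -ltNge.
Qed.

Lemma S_opbound : opbound S (\sum_(k <- J) (`|v k| * `|psi (inl k)| + `|psi (inl k)| * `|v k|)).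
Proof.
move=> x; rewrite SE (le_trans (ler_norm_sum _ _ _)) // mulr_suml.
apply: ler_sum => k _; rewrite (le_trans (ler_normD _ _)) // mulrDl !normrZ.
by rewrite lerD // mulrAC ler_wpM2r // cauchy_schwarz_norm.
Qed.

(** The two diagonal blocks of an operator have orthogonal ranges, and so have the
    two off-diagonal ones. *)
Lemma orth_sum_le (u w x : V) (C : R) : 0 <= C -> ip u w = 0 ->
  `|u| <= C * `|P x| -> `|w| <= C * `|Q x| -> `|u + w| <= C * `|x|.
Proof.
move=> C0 uw uC wC.
rewrite -(@ler_pXn2r _ 2) ?nnegrE ?mulr_ge0 // (pythagoras ipN uw).
rewrite exprMn [X in _ * X](PJ_pythagoras ipN es x JD) mulrDr -!exprMn.
by apply: lerD; rewrite ler_pXn2r ?nnegrE ?mulr_ge0.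
Qed.

Lemma PQ_decomp x : x = P x + Q x.
Proof. by rewrite /Q addrC subrK. Qed.

Lemma PQ0 x : P (Q x) = 0.
Proof. by rewrite /Q (linB (PJ_lin es JD)) (PJ_idem es) // subrr. Qed.

Lemma QP x : Q (P x) = 0.
Proof. by apply: QP0; exact: (PJ_idem es). Qed.

Lemma QQ x : Q (Q x) = Q x.
Proof. by rewrite {1}/Q PQ0 subr0. Qed.

Lemma Qself : self_adjoint ip Q.
Proof. by move=> x y; rewrite /Q ipBl ipBr P_self. Qed.

Lemma ip_PQ x y : ip (P x) (Q y) = 0.
Proof. exact: (PJ_orth ipN es). Qed.

Lemma Phat_idem x : Phat (Phat x) = Phat x.
Proof. exact: (PJ_idem eshat). Qed.

Lemma Phat_self : self_adjoint ip Phat.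
Proof. exact: (PJ_self_adjoint ipN eshat). Qed.

Lemma linPhat : linear Phat.
Proof. exact: (PJ_lin eshat). Qed.

Lemma linP : linear P.
Proof. exact: (PJ_lin es). Qed.

Lemma Phat_norm x : `|Phat x| <= `|x|.
Proof. exact: (PJ_norm ipN eshat). Qed.

Lemma Qhat_norm x : `|Qhat x| <= `|x|.
Proof. exact: (PJC_norm ipN eshat). Qed.

Lemma P_norm x : `|P x| <= `|x|.
Proof. exact: (PJ_norm ipN es). Qed.

Lemma QhatQhat x : Qhat (Qhat x) = Qhat x.
Proof. by rewrite /Qhat (linB linPhat) Phat_idem subrr subr0. Qed.

Lemma Qhatself : self_adjoint ip Qhat.
Proof. by move=> x y; rewrite /Qhat ipBl ipBr Phat_self. Qed.

Lemma linremainder : linear err.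
Proof.
move=> t x y; rewrite /err linPhat linP linS !scalerBr !opprD.
by rewrite (addrACA (t *: Phat x)) (addrACA (t *: Phat x - t *: P x)).
Qed.

Lemma remainder_self : self_adjoint ip err.
Proof. by move=> x y; rewrite /err !ipBl !ipBr Phat_self P_self Sself. Qed.

(** [Phat - P = Phat Q - Qhat P] is a sum of orthogonal terms. *)
Lemma proj_diff_norm x : `|Phat x - P x| <= `|x|.
Proof.
have -> : Phat x - P x = - Qhat (P x) + Phat (Q x).
  rewrite /Qhat /Q (linB linPhat); set u := Phat (P x).
  by rewrite opprB [RHS]addrC addrA subrK.
rewrite -[leRHS]mul1r; apply: orth_sum_le => //.
- by rewrite ipNl ipC (PJ_orth ipN eshat) // oppr0.
- by rewrite normrN mul1r Qhat_norm.
- by rewrite mul1r Phat_norm.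
Qed.

(** If [Q Phat] has norm below one, the square matrix of inner products between
    the two families of [#|J|] eigenvectors is invertible, so that every vector
    in the range of [P] is the projection of one in the range of [Phat]. *)
Lemma rank_swap (tau : R) : 0 <= tau -> opbound (Q \o Phat) tau ->
  opbound (Qhat \o P) tau.
Proof.
move=> tau0 Qtau x /=.
have [tau1|tau1] := leP 1 tau.
  rewrite (le_trans (Qhat_norm _)) // (le_trans (P_norm _)) //.
  by rewrite -{1}[ `|x| ]mul1r ler_wpM2r.
apply: (@le_trans _ _ (tau * `|P x|)); last by rewrite ler_wpM2l ?P_norm.
have : P (P x) = P x by rewrite (PJ_idem es).
move: (P x) => y {x} Py.
pose n := size J; pose k (i : 'I_n) := nth 0%N J i.
have kJ i : k i \in J by apply: mem_nth.
pose M : 'M[R]_n := \matrix_(j, i) ip (psi (inl (k i))) (psihat (inl (k j))).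
pose xx (u : 'rV[R]_n) := \sum_(j < n) u 0 j *: psihat (inl (k j)).
have xxM u i : ip (psi (inl (k i))) (xx u) = (u *m M) 0 i.
  by rewrite /xx ip_sumr mxE; apply: eq_bigr => j _; rewrite ipZr mxE.
have Phatxx u : Phat (xx u) = xx u.
  rewrite /xx (lin_sum linPhat); apply: eq_bigr => j _.
  by rewrite (linZ linPhat) (PJ_basis eshat).
have onk i : D i -> ~ off s J i -> exists j, i = inl (k j).
  move=> Di /(onP Di) [k' k'J ->].
  have h : (index k' J < n)%N by rewrite index_mem.
  by exists (Ordinal h); rewrite /k nth_index.
have Pxx u y' : P y' = y' -> (forall i, ip (psi (inl (k i))) y' = (u *m M) 0 i) ->
    P (xx u) = y'.
  move=> Py' yu; apply: (coord_ext ob) => i Di.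
  have [io|io] := pselect (off s J i).
    rewrite -Py' !(PJ_coord es) //.
    by case/offP: io => _ ->; rewrite !mul0r.
  have [j ->] := onk _ Di io; rewrite (PJ_coord es) //; last exact: JD.
  by rewrite /= kJ mul1r xxM yu.
have unitM : M \in unitmx.
  rewrite -row_free_unit -kermx_eq0; apply: contraT => /rowV0Pn [u /sub_kermxP uM u0].
  have Pxu : P (xx u) = 0.
    by apply: Pxx => [|i]; rewrite ?(lin0 linP) // uM mxE ip0r.
  have : `|xx u| <= tau * `|xx u|.
    by have := Qtau (xx u); rewrite /= Phatxx {1}/Q Pxu subr0.
  rewrite -subr_le0 -{1}[ `|xx u| ]mul1r -mulrBl pmulr_rle0 ?subr_gt0 // normr_le0.
  move=> /eqP xu0; case/negP: u0; apply/eqP/rowP => j; rewrite mxE.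
  have := ip0r ip (psihat (inl (k j))); rewrite -xu0 /xx ip_sumr (bigD1 j) //=.
  rewrite ipZr (ip_basis obhat) ?eqxx ?mulr1; try exact: JDhat.
  rewrite big1 ?addr0 // => j' jj'; rewrite ipZr (ip_basis obhat); try exact: JDhat.
  case: eqP => [[/eqP]|_]; last by rewrite mulr0.
  rewrite /k nth_uniq ?fset_uniq // => /eqP /val_inj jj.
  by rewrite jj eqxx in jj'.
pose u := (\row_i ip (psi (inl (k i))) y) *m invmx M.
have Pxu : P (xx u) = y.
  by apply: Pxx => // i; rewrite /u mulmxKV // mxE.
have h1 : `|y| ^+ 2 <= `|Phat y| * `|xx u|.
  rewrite -ipN -{2}Pxu -P_self Py -[X in ip y X]Phatxx -Phat_self.
  exact: (cauchy_schwarz ipN).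
have h2 : (1 - tau ^+ 2) * `|xx u| ^+ 2 <= `|y| ^+ 2.
  have hp := PJ_pythagoras ipN es (xx u) JD; rewrite Pxu in hp.
  have hq : `|xx u - y| ^+ 2 <= tau ^+ 2 * `|xx u| ^+ 2.
    rewrite -exprMn ler_pXn2r ?nnegrE ?mulr_ge0 // -{1}Pxu.
    by have := Qtau (xx u); rewrite /= Phatxx.
  by rewrite mulrBl mul1r; lra.
have h3 := PJ_pythagoras ipN eshat y JDhat.
rewrite -(@ler_pXn2r _ 2) ?nnegrE ?mulr_ge0 // exprMn.
have -> : `|Qhat y| ^+ 2 = `|y| ^+ 2 - `|Phat y| ^+ 2 by rewrite h3 addrC addKr.
have [->|y0] := eqVneq y 0.
  by rewrite (lin0 linPhat) normr0 expr0n mulr0 subrr.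
have y20 : 0 < `|y| ^+ 2 by rewrite sqnorm_gt0.
have t2 : 0 < 1 - tau ^+ 2 by rewrite subr_gt0 expr_lt1.
have h4 : (`|y| ^+ 2) ^+ 2 <= `|Phat y| ^+ 2 * `|xx u| ^+ 2.
  by rewrite -exprMn ler_pXn2r ?nnegrE ?sqr_ge0 ?mulr_ge0.
suff : (1 - tau ^+ 2) * `|y| ^+ 2 <= `|Phat y| ^+ 2 by lra.
rewrite -(ler_pM2r y20).
have : (1 - tau ^+ 2) * (`|y| ^+ 2) ^+ 2 <= `|Phat y| ^+ 2 * `|y| ^+ 2.
  apply: le_trans (ler_wpM2l (ltW t2) h4) _.
  by rewrite mulrCA ler_wpM2l ?sqr_ge0.
by rewrite expr2 mulrA.
Qed.

(** * Operator norm of the remainder *)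

Section Grouped.
Variable label : nat -> nat.
Hypothesis grouping : forall b, b \in labels J label ->
  exists c r, interval_block (bucket J label b) c r.

Local Notation m := (#|` labels J label|%:R : R).
Local Notation sqm := (Num.sqrt (#|` labels J label|%:R : R)).

Lemma sqm_ge0 : 0 <= sqm. Proof. exact: sqrtr_ge0. Qed.

(** [S] solves the Sylvester equation with source [- E]. *)
Lemma QS_block y : P y = y -> `|Q (S y)| <= sqm * a * `|y|.
Proof.
move=> Py; rewrite (bucket_bound ipN es JD (B := Q \o S)) //.
  exact: lin_comp linQ linS.
move=> b x bl bx; have [c [r Kcr]] := grouping bl.
have g0 := sqrt_gap_gt0 gam0.
have gg : Num.sqrt gam ^+ 2 = gam by rewrite sqr_sqrtr // ltW.
have r0 : 0 < r + gam by case: Kcr => _ _ _ r0 _; exact: ltr_wpDl.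
have : `|(Q \o S) x| <= (a * gam) / gam * `|x|; last by rewrite mulfK // gt_eqF.
pose C0 := \sum_(k <- J) (`|v k| * `|psi (inl k)| + `|psi (inl k)| * `|v k|).
apply: (block_sylvester Kcr (B := Q \o S) (g := fun y => - E y) (C0 := C0)) => //=.
- exact: lin_comp linQ linS.
- by move=> z Pz l lo; rewrite !Q_off // S_sylvester.
- by move=> z i Di io; rewrite Q_on.
- by move=> z /=; rewrite (le_trans (Q_norm _)) // S_opbound.
- by rewrite mulr_ge0 // ltW.
move=> z Pz; have sb := shres_bounded Kcr.
rewrite (linN (diagop_lin ipN ob sb)) normrN (le_trans (shres_E_le Kcr _)) //.
rewrite Tinv_on // normrZ gtr0_norm //.
have -> : Num.sqrt gam / (r + gam) * (a * (Num.sqrt gam * `|z|)) =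
   a * Num.sqrt gam ^+ 2 / (r + gam) * `|z| by ring.
by rewrite gg.
Qed.

Lemma S_norm x : `|S x| <= sqm * a * `|x|.
Proof.
have Sa : 0 <= sqm * a by rewrite mulr_ge0 ?sqm_ge0.
have b1 : opbound (Q \o S \o P) (sqm * a).
  move=> y /=; rewrite (le_trans (QS_block _)) ?(PJ_idem es) // ler_wpM2l //.
  exact: P_norm.
have adj : adjoint_pair ip (Q \o S \o P) (P \o S \o Q).
  by move=> y z; rewrite /= Qself Sself P_self.
have b2 := opbound_adj ipN adj b1.
have -> : S x = Q (S (P x)) + P (S (Q x)).
  have h1 : S (P x) = Q (S (P x)) by rewrite [LHS]PQ_decomp P_S_P add0r.
  have h2 : S (Q x) = P (S (Q x)) by rewrite [LHS]PQ_decomp Q_S_Q addr0.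
  by rewrite -h1 -h2 {1}(PQ_decomp x) (linD linS).
apply: orth_sum_le => //.
- by rewrite ipC ip_PQ.
- by rewrite QS_block // (PJ_idem es).
- by have := b2 (Q x); rewrite /= QQ.
Qed.

(** For a large perturbation the norms of [Phat - P] and of [S] suffice. *)
Lemma remainder_norm_crude x : `|err x| <= (1 + sqm * a) * `|x|.
Proof.
by rewrite mulrDl mul1r (le_trans (ler_normB _ _)) // lerD ?proj_diff_norm ?S_norm.
Qed.

Hypothesis a4 : a <= 1 / 4.

(** Bounds for [Q Phat] and, in units of [sqrt gap], for [Tinv Q Phat]. *)
Definition defect := sqm * (2 * a / (2 - 5 * a + a ^+ 2)).
Definition weighted_defect := sqm * (a * (3 - a) / (2 - 5 * a + a ^+ 2)).
Local Notation tau := defect.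
Local Notation om := weighted_defect.

Lemma denom_gt0 : 0 < 2 - 5 * a + a ^+ 2.
Proof. by have := sqr_ge0 a; have := a4; lra. Qed.

Lemma tau_ge0 : 0 <= tau.
Proof.
have d0 := denom_gt0.
by rewrite /tau mulr_ge0 ?sqm_ge0 // divr_ge0 ?(ltW d0) // mulr_ge0.
Qed.

Lemma om_ge0 : 0 <= om.
Proof.
have d0 := denom_gt0; have := a4 => a4'.
by rewrite /om mulr_ge0 ?sqm_ge0 // divr_ge0 ?(ltW d0) // mulr_ge0 //; lra.
Qed.

Lemma Q_Phat : opbound (Q \o Phat) tau.
Proof.
have d0 := denom_gt0.
move=> x /=; apply: (@le_trans _ _ (tau * `|Phat x|)); last first.
  by rewrite ler_wpM2l ?tau_ge0 // Phat_norm.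
apply: (bucket_bound ipN eshat JDhat (label := label) (B := Q)) => //.
- exact: linQ.
- by rewrite divr_ge0 ?(ltW d0) // mulr_ge0.
- by move=> b y /grouping [c [r Kcr]]; exact: (block_Q_bound Kcr a4).
exact: Phat_idem.
Qed.

Lemma TinvQ_Phat : opbound (Ti \o Q \o Phat) (om * Num.sqrt gam).
Proof.
have d0 := denom_gt0; have := a4 => a4'.
move=> x /=; apply: (@le_trans _ _ (om * Num.sqrt gam * `|Phat x|)); last first.
  by rewrite ler_wpM2l ?Phat_norm // mulr_ge0 ?om_ge0 ?sqrtr_ge0.
rewrite /om -(mulrA sqm).
apply: (bucket_bound ipN eshat JDhat (label := label) (B := Ti \o Q)) => //.
- exact: lin_comp linTinv linQ.
- rewrite mulr_ge0 ?sqrtr_ge0 // divr_ge0 ?(ltW d0) // mulr_ge0 //; lra.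
- by move=> b y /grouping [c [r Kcr]]; exact: (block_TinvQ_le Kcr a4).
exact: Phat_idem.
Qed.

Lemma Qhat_P : opbound (Qhat \o P) tau.
Proof. exact: rank_swap tau_ge0 Q_Phat. Qed.

Lemma P_Qhat : opbound (P \o Qhat) tau.
Proof.
by apply: (opbound_adj ipN _ Qhat_P) => x y; rewrite /= Qhatself P_self.
Qed.

Lemma Phat_Q : opbound (Phat \o Q) tau.
Proof.
by apply: (opbound_adj ipN _ Q_Phat) => x y; rewrite /= Qself Phat_self.
Qed.

Lemma Phat_Tinv : opbound (Phat \o Ti) (Num.sqrt gam * (1 + om)).
Proof.
apply: (@opbound_adj _ _ _ ipN (Ti \o Phat)).
  by move=> x y; rewrite /= Tinv_self Phat_self.
move=> x /=; rewrite (le_trans (Tinv_norm_le _)) // mulrDr mulr1 mulrDl lerD //.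
  by rewrite ler_wpM2l ?sqrtr_ge0 // (le_trans (P_norm _)) // Phat_norm.
by rewrite (mulrC (Num.sqrt gam)); exact: TinvQ_Phat.
Qed.

Lemma Phat_Tinv_le x : `|Phat (Ti x)| <= Num.sqrt gam * (1 + om) * `|x|.
Proof. exact: Phat_Tinv. Qed.

Lemma Q_Phat_le x : `|Q (Phat x)| <= tau * `|x|.
Proof. exact: Q_Phat. Qed.

Lemma P_Qhat_le x : `|P (Qhat x)| <= tau * `|x|.
Proof. exact: P_Qhat. Qed.

(** Source of the Sylvester equation solved by [Q (Phat - P - S) P]: the first
    order cancels against [S], so what remains is of second order. *)
Definition source y := E (Qhat y) + Phat (E y).

Lemma remainder_sylvester y : P y = y -> forall l, off s J l ->
  lam l * ip (psi l) (err y) = ip (psi l) (err (H y)) + ip (psi l) (source y).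
Proof.
move=> Py l lo; have Dl := off_used lo.
have Sy := S_sylvester Py lo; rewrite ipNr in Sy.
have on0 z : P z = z -> ip (psi l) z = 0.
  by move=> <-; rewrite (PJ_coord es) //; case/offP: lo => _ ->; rewrite mul0r.
have Hy0 : ip (psi l) (H y) = 0 by rewrite on0 // (PJ_comm Hself es) // Py.
have HPhat : H (Phat y) = Phat (H y) + Phat (E y) - E (Phat y).
  rewrite -(linD linPhat) /E (addrC (H y)) subrK (PJ_comm Hhatself eshat) //.
  by rewrite opprB addrCA subrr addr0.
have lamPhat : lam l * ip (psi l) (Phat y) = ip (psi l) (Phat (H y))
     + ip (psi l) (Phat (E y)) - ip (psi l) (E (Phat y)).
  by rewrite -(eigval_coord Hself es) // HPhat [LHS]ipBr ipDr.
have lamy : ip (psi l) y = 0 by exact: on0.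
have PHy : P (H y) = H y by rewrite (PJ_comm Hself es) // Py.
have -> : ip (psi l) (err y) = ip (psi l) (Phat y) - ip (psi l) (S y).
  by rewrite /err Py !ipBr lamy subr0.
have -> : ip (psi l) (err (H y)) = ip (psi l) (Phat (H y)) - ip (psi l) (S (H y)).
  by rewrite /err PHy !ipBr Hy0 subr0.
have -> : ip (psi l) (source y) =
    ip (psi l) (E y) - ip (psi l) (E (Phat y)) + ip (psi l) (Phat (E y)).
  by rewrite /source ipDr {1}/Qhat (linB linE); congr (_ + _); exact: ipBr.
by rewrite mulrBr lamPhat Sy; ring.
Qed.

Lemma Tinv_Qhat y : P y = y ->
  `|Ti (Qhat y)| <= Num.sqrt gam * (om + tau ^+ 2) * `|y|.
Proof.
move=> Py; rewrite (le_trans (Tinv_norm_le _)) //.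
have -> : Q (Qhat y) = - Q (Phat y) by rewrite /Qhat (linB linQ) (QP0 Py) sub0r.
rewrite (linN linTinv) normrN addrC mulrDr mulrDl lerD //.
  by rewrite (mulrC (Num.sqrt gam)); exact: TinvQ_Phat.
rewrite -mulrA ler_wpM2l ?sqrtr_ge0 //.
have h1 := P_Qhat (Qhat y); rewrite /= QhatQhat in h1.
have h2 := Qhat_P y; rewrite /= Py in h2.
by rewrite (le_trans h1) // expr2 -mulrA ler_wpM2l ?tau_ge0.
Qed.

Lemma Phat_E y : P y = y -> `|Phat (E y)| <= gam * (a * (1 + om)) * `|y|.
Proof.
have gg : Num.sqrt gam ^+ 2 = gam by rewrite sqr_sqrtr // ltW.
have g0 := sqrt_gap_gt0 gam0.
move=> Py; rewrite E_factor (Tinv_on Py).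
have o1 : 0 <= Num.sqrt gam * (1 + om).
  by rewrite mulr_ge0 ?sqrtr_ge0 // addr_ge0 ?om_ge0.
rewrite (le_trans (Phat_Tinv_le _)) //.
apply: le_trans (ler_wpM2l o1 (Abound _)) _.
rewrite normrZ gtr0_norm // -[X in _ <= X * _ * _]gg.
by rewrite le_eqVlt; apply/orP; left; apply/eqP; ring.
Qed.

Lemma source_bound_ge0 : 0 <= a * (om + tau ^+ 2) + tau * (a * (1 + om)).
Proof.
have p1 := addr_ge0 om_ge0 (sqr_ge0 tau); have p2 := addr_ge0 ler01 om_ge0.
exact: addr_ge0 (mulr_ge0 a0 p1) (mulr_ge0 tau_ge0 (mulr_ge0 a0 p2)).
Qed.

Lemma Q_remainder_block y : P y = y ->
  `|Q (err y)| <= sqm * (a * (om + tau ^+ 2) + tau * (a * (1 + om))) * `|y|.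
Proof.
have o0 := om_ge0; have t0 := tau_ge0.
have c0 := source_bound_ge0.
move=> Py; rewrite (bucket_bound ipN es JD (B := Q \o err)) //.
  exact: lin_comp linQ linremainder.
move=> b x bl bx; have [c [r Kcr]] := grouping bl.
have g0 := sqrt_gap_gt0 gam0.
have gg : Num.sqrt gam ^+ 2 = gam by rewrite sqr_sqrtr // ltW.
have r0 : 0 < r + gam by case: Kcr => _ _ _ r0 _; exact: ltr_wpDl.
set C := (a * _ + _) in c0 *.
have : `|(Q \o err) x| <= (gam * C) / gam * `|x|; last by rewrite (mulrC gam) mulfK // gt_eqF.
apply: (block_sylvester Kcr (B := Q \o err) (g := source) (C0 := 1 + sqm * a)) => //=.
- exact: lin_comp linQ linremainder.
- by move=> z Pz l lo; rewrite !Q_off // remainder_sylvester.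
- by move=> z i Di io; rewrite Q_on.
- by move=> z /=; rewrite (le_trans (Q_norm _)) // remainder_norm_crude.
- by rewrite mulr_ge0 // ltW.
move=> z Pz; have sb := shres_bounded Kcr.
rewrite /source (linD (diagop_lin ipN ob sb)) (le_trans (ler_normD _ _)) //.
have -> : gam * C / (r + gam) * `|z| =
  gam * (a * (om + tau ^+ 2)) / (r + gam) * `|z| +
  (r + gam)^-1 * (tau * (gam * (a * (1 + om)) * `|z|)) by rewrite /C; ring.
apply: lerD.
  rewrite (le_trans (shres_E_le Kcr _)) //.
  have w0 : 0 <= Num.sqrt gam / (r + gam) by rewrite divr_ge0 // ltW.
  apply: le_trans (ler_wpM2l w0 (ler_wpM2l a0 (Tinv_Qhat Pz))) _.
  rewrite -[X in _ <= X * _ / _ * _]gg.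
  by rewrite le_eqVlt; apply/orP; left; apply/eqP; ring.
rewrite -dg_off_Q //; last exact: shres_out.
rewrite (le_trans (diagop_le ipN ob _ (shres_le Kcr))) //.
rewrite ler_wpM2l ?invr_ge0 ?(ltW r0) // -Phat_idem.
rewrite (le_trans (Q_Phat_le _)) //.
by rewrite ler_wpM2l // Phat_E.
Qed.

Lemma P_remainder_P x : P (err (P x)) = - P (Qhat (P x)).
Proof.
have PP : P (P x) = P x by rewrite (PJ_idem es).
have e1 : err (P x) = Phat (P x) - P x - S (P x) by rewrite /err PP.
have e2 : Qhat (P x) = P x - Phat (P x) by [].
by rewrite e1 e2 !(linB linP) P_S_P PP subr0 opprB.
Qed.

Lemma Q_remainder_Q x : Q (err (Q x)) = Q (Phat (Q x)).
Proof.
have e1 : err (Q x) = Phat (Q x) - S (Q x) by rewrite /err PQ0 subr0.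
by rewrite e1 (linB linQ) Q_S_Q subr0.
Qed.

Lemma P_Qhat_P x : `|P (Qhat (P x))| <= tau ^+ 2 * `|P x|.
Proof.
rewrite -QhatQhat; rewrite (le_trans (P_Qhat_le _)) // expr2 -mulrA ler_wpM2l ?tau_ge0 //.
by have := Qhat_P (P x); rewrite /= (PJ_idem es).
Qed.

Lemma Q_Phat_Q x : `|Q (Phat (Q x))| <= tau ^+ 2 * `|Q x|.
Proof.
rewrite -Phat_idem; rewrite (le_trans (Q_Phat_le _)) // expr2 -mulrA ler_wpM2l ?tau_ge0 //.
by have := Phat_Q (Q x); rewrite /= QQ.
Qed.

Lemma remainder_norm x : `|err x| <=
  (tau ^+ 2 + sqm * (a * (om + tau ^+ 2) + tau * (a * (1 + om)))) * `|x|.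
Proof.
have o0 := om_ge0; have t0 := tau_ge0.
set C := sqm * _.
have C0 : 0 <= C := mulr_ge0 sqm_ge0 source_bound_ge0.
have b1 : opbound (Q \o err \o P) C.
  move=> y /=; rewrite (le_trans (Q_remainder_block _)) ?(PJ_idem es) // ler_wpM2l //.
  exact: P_norm.
have adj : adjoint_pair ip (Q \o err \o P) (P \o err \o Q).
  by move=> y z; rewrite /= Qself remainder_self P_self.
have b2 := opbound_adj ipN adj b1.
have -> : err x = (P (err (P x)) + Q (err (Q x))) + (Q (err (P x)) + P (err (Q x))).
  rewrite addrACA (addrC (Q (err (Q x)))) -!PQ_decomp -(linD linremainder).
  by rewrite -PQ_decomp.
rewrite (le_trans (ler_normD _ _)) // mulrDl; apply: lerD; apply: orth_sum_le.
- exact: sqr_ge0.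
- by rewrite ip_PQ.
- by rewrite P_remainder_P normrN P_Qhat_P.
- by rewrite Q_remainder_Q Q_Phat_Q.
- by [].
- by rewrite ipC ip_PQ.
- by rewrite Q_remainder_block // (PJ_idem es).
- by have := b2 (Q x); rewrite /= QQ.
Qed.

(** * Hilbert-Schmidt norm of the remainder *)

Local Notation hs := (sq_hs D psi).
Local Notation hshat := (sq_hs Dhat psihat).

Lemma a_le1 : a <= 1. Proof. by have := a4; lra. Qed.

Definition Jidx : {fset (nat + nat)} := [fset (inl k : nat + nat) | k in J]%fset.

(** The square of [betaJ] ([betaE]), a finite sum because [P] has finite rank. *)
Definition sq_beta : R := \sum_(i <- Jidx) `|Q (A (P (psi i)))| ^+ 2.

Lemma sq_beta_ge0 : 0 <= sq_beta.
Proof. by apply: sumr_ge0 => i _; exact: sqr_ge0. Qed.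

Lemma Jidx_used (s' : eigensystem V) : used_block s' J -> forall i, i \in Jidx -> eigidx s' i.
Proof. by move=> KD i /imfsetP [k /= kJ ->]; exact: KD. Qed.

Lemma Jidx_out i : i \notin Jidx -> in_block (R := R) J i = 0.
Proof.
case: i => [k|j] //= kJ; case: (boolP (k \in J)) => // kJ'.
by case/negP: kJ; apply/imfsetP; exists k.
Qed.

Lemma P_out i : D i -> i \notin Jidx -> P (psi i) = 0.
Proof. by move=> Di iJ; rewrite (PJ_out es) // Jidx_out. Qed.

Lemma Phat_out i : Dhat i -> i \notin Jidx -> Phat (psihat i) = 0.
Proof. by move=> Di iJ; rewrite (PJ_out eshat) // Jidx_out. Qed.

Lemma hs_QAP : hs (Q \o A \o P) = sq_beta%:E.
Proof.
apply: sq_hs_fset => [|i Di iJ /=]; first exact: Jidx_used.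
by rewrite P_out // (lin0 linA) (lin0 linQ).
Qed.

Lemma hs_basis_change (B B' : V -> V) : adjoint_pair ip B B' -> hshat B = hs B.
Proof.
move=> BB; have B'B : adjoint_pair ip B' B by move=> x y; rewrite ipC -BB ipC.
by rewrite (sq_hs_adjoint ipN obhat ob BB) (sq_hs_adjoint ipN ob ob B'B).
Qed.

Lemma hs_adj (B B' : V -> V) : adjoint_pair ip B B' -> hs B = hs B'.
Proof. by move=> BB; rewrite (sq_hs_adjoint ipN ob ob BB). Qed.

Lemma absR_E_P x : absR_half ip s J (E (P x)) = Num.sqrt gam *: Q (A (P x)).
Proof.
have PP : P (P x) = P x by rewrite (PJ_idem es).
rewrite E_factor (Tinv_on PP) (linZ linA) (linZ linTinv).
apply: (coord_ext ob) => i Di; rewrite (absR_half_coord ipN ob J0 gam0) // !ipZr Tinv_coord //.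
have [io|io] := pselect (off s J i); last by rewrite memNset // Q_on // mul0r mulr0.
rewrite mem_set // Q_off // mulrCA; congr (_ * _).
by rewrite mulrA mulVf ?mul1r // gt_eqF // (wt_gt0 J0).
Qed.

Lemma absR_self : self_adjoint ip (absR_half ip s J).
Proof.
move=> x y; rewrite !(absR_half_diagop ip).
by apply: (diagop_self_adjoint ipN ob); exact: inv_wt_off_bounded.
Qed.

Lemma betaE : betaJ ip s J E = (Num.sqrt sq_beta)%:E.
Proof.
have adj : adjoint_pair ip (absR_half ip s J \o E \o P) (P \o E \o absR_half ip s J).
  by move=> x y; rewrite /= absR_self Eself P_self.
have g0 := sqrt_gap_gt0 gam0.
rewrite /betaJ (hs_normE ipN ob adj).
have -> : hs (absR_half ip s J \o E \o P) = (gam * sq_beta)%:E.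
  rewrite (@sq_hs_fset _ _ _ _ _ Jidx); last 2 first.
  - exact: Jidx_used.
  - move=> i Di iJ /=; rewrite absR_E_P P_out //.
    by rewrite (lin0 linA) (lin0 linQ) scaler0.
  congr EFin; rewrite mulr_sumr; apply: eq_bigr => i _ /=.
  by rewrite absR_E_P normrZ exprMn real_normK ?num_real // sqr_sqrtr // ltW.
rewrite /= -EFinM sqrtrM ?(ltW gam0) // mulKf // gt_eqF //.
Qed.

(** Entrywise resolvent bound at one perturbed eigenvalue:
    [|lam l - lamhat j| >= dist l - a * gap >= 3/4 * dist l]. *)
Lemma psihat_resolvent_le j i : j \in J -> D i ->
  `|shres (lamhat (inl j)) i * wt i ^+ 2| <= 4 / 3.
Proof.
move=> jJ Di; rewrite /shres; case: ifPn => [/set_mem lo|_]; last first.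
  by rewrite mul0r normr0 divr_ge0.
have d0 := dist_gt0 J0 gam0 lo.
have h1 := eigval_perturbation a_le1 jJ.
have h2 := dist_le s i jJ; have h3 := gap_le_dist J0 lo.
have h4 : `|lamhat (inl j) - lam (inl j)| <= 1 / 4 * dist s J i.
  by apply: le_trans h1 _; apply: ler_pM => //; exact: ltW.
have h5 : 3 / 4 * dist s J i <= `|lam i - lamhat (inl j)|.
  have := ler_normD (lam i - lamhat (inl j)) (lamhat (inl j) - lam (inl j)).
  by rewrite addrA subrK; lra.
rewrite normrM normfV (wt_sqr_off J0) // (gtr0_norm d0).
rewrite ler_pdivrMl; last by apply: lt_le_trans h5; rewrite mulr_gt0.
by lra.
Qed.

Lemma lamhat_off j l : j \in J -> off s J l -> lam l != lamhat (inl j).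
Proof.
move=> jJ lo; have d0 := dist_gt0 J0 gam0 lo.
have h1 := eigval_perturbation a_le1 jJ.
have h2 := dist_le s l jJ; have h3 := gap_le_dist J0 lo.
apply/eqP => e; move: h2; rewrite e.
have : a * gam <= 1 / 4 * gam by rewrite ler_wpM2r // ltW.
lra.
Qed.

Lemma shres_lamhat_bounded j : j \in J -> bounded_symbol D (shres (lamhat (inl j))).
Proof.
move=> jJ; exists (4 / 3 / gam) => i Di.
have := psihat_resolvent_le jJ Di; have [lo|lo] := pselect (off s J i); last first.
  by rewrite shres_out // normr0 !divr_ge0 // ltW.
rewrite (wt_sqr_off J0) // normrM (gtr0_norm (dist_gt0 J0 gam0 lo)) => h.
rewrite ler_pdivlMr //; apply: le_trans h; rewrite ler_wpM2l //.
exact: gap_le_dist.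
Qed.

Local Notation W := (Ti \o Q \o Phat).

(** The weighted norm of [Q Phat] occurs on both sides of the resolvent identity;
    for [a <= 1/4] its coefficient on the right is [1/3], and it is absorbed. *)
Lemma hshat_W : (hshat W <= (4 * gam * sq_beta)%:E)%E.
Proof.
pose w2 := \sum_(i <- Jidx) `|W (psihat i)| ^+ 2.
have WE : hshat W = w2%:E.
  apply: sq_hs_fset => [|i Di iJ /=]; first exact: Jidx_used.
  by rewrite Phat_out // (lin0 linQ) (lin0 linTinv).
have adj : adjoint_pair ip (Q \o A \o P) (P \o A \o Q).
  by move=> x y; rewrite /= Qself Aself P_self.
have : (hshat W <= (8 / 3 * gam * sq_beta + 1 / 3 * w2)%:E)%E.
  have a4' := a4.
  apply: (sq_hs_le_comb (B := Q \o A \o P) (C := W)); first by rewrite mulr_ge0 // ltW.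
  - by [].
  - move=> i Di; have [iJ|iJ] := boolP (i \in Jidx); last first.
      rewrite /= Phat_out // (lin0 linQ) (lin0 linTinv) normr0 expr0n /=.
      by rewrite addr_ge0 // !mulr_ge0 // ?ltW // sqr_ge0.
    have /imfsetP [j /= jJ ij] := iJ.
    have Phi : Phat (psihat i) = psihat i by rewrite ij (PJ_basis eshat).
    have sb := shres_lamhat_bounded jJ.
    have We : W (psihat i) = - dg (fun l => shres (lamhat (inl j)) l * wt l ^+ 2)
        (Q (A (Ti (psihat i)))).
      rewrite /= Phi (TinvQ_resolvent _ sb); last by move=> l; exact: lamhat_off.
      have -> : Hhat (psihat i) - lamhat (inl j) *: psihat i = 0.
        by case: eshat => _ -> // _ _ _; rewrite ij subrr.
      rewrite (lin0 linQ) (lin0 (diagop_lin ipN ob (symbolM_bounded sb wtb))) sub0r.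
      congr (- _); rewrite dg_off_Q //.
        exact: symbolM_bounded sb wt_sqr_bounded.
      by move=> l lo; rewrite shres_out // mul0r.
    have h1 : `|W (psihat i)| <= 4 / 3 * `|Q (A (Ti (psihat i)))|.
      by rewrite We normrN; apply: (diagop_le ipN ob) => l; exact: psihat_resolvent_le.
    have h2 : `|Q (A (Ti (psihat i)))| <=
        Num.sqrt gam * `|Q (A (P (psihat i)))| + 1 / 4 * `|W (psihat i)|.
      rewrite {1}Tinv_split (linD linA) (linZ linA) (linD linQ) (linZ linQ).
      rewrite (le_trans (ler_normD _ _)) // normrZ ger0_norm ?sqrtr_ge0 // lerD2l.
      rewrite (le_trans (Q_norm _)) // (le_trans (Abound _)) //= Phi ler_wpM2r //.
    have gg : Num.sqrt gam ^+ 2 = gam by rewrite sqr_sqrtr // ltW.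
    rewrite -gg /=; move: h1 h2 (normr_ge0 (W (psihat i))) => /=.
    move: `|Q (A (Ti (psihat i)))| `|Q (A (P (psihat i)))| (Num.sqrt gam) `|Ti _|.
    move=> f p g w h1 h2 w0.
    have h3 : w <= 4 / 3 * (g * p) + 1 / 3 * w by lra.
    (* The squared sum is split by a weighted arithmetic-geometric inequality,
       with equality at the expected bound [w = 2 * g * p]. *)
    have h4 : w ^+ 2 <= (4 / 3 * (g * p) + 1 / 3 * w) ^+ 2.
      by rewrite ler_pXn2r ?nnegrE // (le_trans w0).
    apply: (le_trans h4); rewrite -subr_ge0.
    have -> : 8 / 3 * g ^+ 2 * p ^+ 2 + 1 / 3 * w ^+ 2 -
      (4 / 3 * (g * p) + 1 / 3 * w) ^+ 2 = 2 / 9 * (2 * (g * p) - w) ^+ 2 by field.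
    by rewrite mulr_ge0 // sqr_ge0.
  - by rewrite (hs_basis_change adj) hs_QAP.
  - by rewrite WE.
by rewrite WE !lee_fin; lra.
Qed.

Lemma hs_W : (hs W <= (4 * gam * sq_beta)%:E)%E.
Proof.
have adj : adjoint_pair ip W (Phat \o Q \o Ti).
  by move=> x y; rewrite /= Tinv_self Qself Phat_self.
by rewrite -(hs_basis_change adj) hshat_W.
Qed.

Lemma TinvQ_ge x : Num.sqrt gam * `|Q x| <= `|Ti (Q x)|.
Proof.
rewrite -[Num.sqrt gam]ger0_norm ?sqrtr_ge0 // -normrZ.
apply: (le_norm_coord ipN ob) => i Di; rewrite ipZr Tinv_coord // !normrM.
rewrite ler_wpM2r // ger0_norm ?sqrtr_ge0 // ger0_norm ?(ltW (wt_gt0 J0 gam0 Di)) //.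
exact: wt_ge.
Qed.

Lemma hs_QPhat : (hs (Q \o Phat) <= (4 * sq_beta)%:E)%E.
Proof.
have g0 := sqrt_gap_gt0 gam0.
have gg : Num.sqrt gam ^+ 2 = gam by rewrite sqr_sqrtr // ltW.
have -> : 4 * sq_beta = (Num.sqrt gam)^-1 ^+ 2 * (4 * gam * sq_beta).
  by rewrite exprVn gg; field; rewrite gt_eqF.
apply: (sq_hs_le_scale (B := W)); [by rewrite invr_ge0 ltW| |exact: hs_W].
by move=> i Di /=; rewrite ler_pdivlMl // TinvQ_ge.
Qed.

(** The two projections have the same rank and [Phat P], [P Phat] are adjoint,
    so the defects [Qhat P] and [Q Phat] have equal Hilbert-Schmidt norms. *)
Lemma hs_QhatP : (hs (Qhat \o P) <= (4 * sq_beta)%:E)%E.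
Proof.
pose n : \bar R := (\sum_(i <- Jidx) (1 : R))%:E.
have hsP : hs P = n.
  rewrite (@sq_hs_fset _ _ _ _ _ Jidx); last 2 first.
  - exact: Jidx_used.
  - by move=> i Di iJ; exact: P_out.
  congr EFin; rewrite big_seq [RHS]big_seq; apply: eq_bigr => i /imfsetP [k /= kJ ->].
  by rewrite P_psi // -ipN (ip_basis ob) ?eqxx //; exact: JD.
have hsPhat : hshat Phat = n.
  rewrite (@sq_hs_fset _ _ _ _ _ Jidx); last 2 first.
  - exact: Jidx_used.
  - by move=> i Di iJ; exact: Phat_out.
  congr EFin; rewrite big_seq [RHS]big_seq; apply: eq_bigr => i /imfsetP [k /= kJ ->].
  by rewrite (PJ_basis eshat) // -ipN (ip_basis obhat) ?eqxx //; exact: JDhat.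
have e1 : hs P = (hs (Phat \o P) + hs (Qhat \o P))%E.
  by apply: sq_hs_eqD => i Di; rewrite (PJ_pythagoras ipN eshat (P (psi i)) JDhat).
have e2 : hshat Phat = (hshat (P \o Phat) + hshat (Q \o Phat))%E.
  by apply: sq_hs_eqD => i Di; rewrite (PJ_pythagoras ipN es (Phat (psihat i)) JD).
have adj : adjoint_pair ip (P \o Phat) (Phat \o P).
  by move=> x y; rewrite /= P_self Phat_self.
have adj2 : adjoint_pair ip (Q \o Phat) (Phat \o Q).
  by move=> x y; rewrite /= Qself Phat_self.
have e3 : hshat (P \o Phat) = hs (Phat \o P) by rewrite (sq_hs_adjoint ipN obhat ob adj).
have e4 := hs_basis_change adj2.
have fin : hs (Phat \o P) \is a fin_num.
  rewrite ge0_fin_numE ?sq_hs_ge0 //; apply: (@le_lt_trans _ _ n); last by rewrite ltry.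
  by rewrite -hsP e1 leeDl // sq_hs_ge0.
have eqn : (hs (Qhat \o P) + hs (Phat \o P) = hs (Q \o Phat) + hs (Phat \o P))%E.
  by rewrite addeC -e1 hsP -hsPhat e2 e3 e4 addeC.
rewrite -[X in (X <= _)%E](addeK _ fin) eqn addeK //.
exact: hs_QPhat.
Qed.

Lemma hs_TinvPhatQ : (hs (Ti \o Phat \o Q) <= (8 * gam * sq_beta)%:E)%E.
Proof.
have adj : adjoint_pair ip (Q \o Phat) (Phat \o Q).
  by move=> x y; rewrite /= Qself Phat_self.
have adjW : adjoint_pair ip W (Phat \o Q \o Ti).
  by move=> x y; rewrite /= Tinv_self Qself Phat_self.
have Q1 : opbound Q 1 by move=> x; rewrite mul1r Q_norm.
have hPQ : (hs (Phat \o Q) <= (4 * sq_beta)%:E)%E by rewrite -(hs_adj adj) hs_QPhat.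
have hWQ : (hs (W \o Q) <= (1 ^+ 2 * (4 * gam * sq_beta))%:E)%E.
  exact: (sq_hs_compr ipN ob adjW Qself ler01 Q1 hs_W).
have -> : 8 * gam * sq_beta = gam * (4 * sq_beta) + 1 * (1 ^+ 2 * (4 * gam * sq_beta)).
  by ring.
apply: (sq_hs_le_comb (B := Phat \o Q) (C := W \o Q)) => //; first exact: ltW.
move=> i Di /=; rewrite (Tinv_pythagoras (Phat (Q (psi i)))) mul1r lerD //.
by rewrite ler_wpM2l ?(ltW gam0) // ler_pXn2r ?nnegrE // P_norm.
Qed.

Lemma hs_TinvQhatP : (hs (Ti \o Qhat \o P) <= (8 * gam * sq_beta)%:E)%E.
Proof.
have adjW : adjoint_pair ip W (Phat \o Q \o Ti).
  by move=> x y; rewrite /= Tinv_self Qself Phat_self.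
have P1 : opbound P 1 by move=> x; rewrite mul1r P_norm.
have hWP : (hs (W \o P) <= (1 ^+ 2 * (4 * gam * sq_beta))%:E)%E.
  exact: (sq_hs_compr ipN ob adjW P_self ler01 P1 hs_W).
have -> : 8 * gam * sq_beta = gam * (4 * sq_beta) + 1 * (1 ^+ 2 * (4 * gam * sq_beta)).
  by ring.
apply: (sq_hs_le_comb (B := Qhat \o P) (C := W \o P)) => //; first exact: ltW.
  move=> i Di /=; rewrite (Tinv_pythagoras (Qhat (P (psi i)))) mul1r lerD //.
    by rewrite ler_wpM2l ?(ltW gam0) // ler_pXn2r ?nnegrE // P_norm.
  have -> : Q (Qhat (P (psi i))) = - Q (Phat (P (psi i))).
    by rewrite /Qhat (linB linQ) QP sub0r.
  by rewrite (linN linTinv) normrN.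
exact: hs_QhatP.
Qed.

Lemma hs_QPhatE : (hs (Q \o Phat \o E \o P) <= (8 * gam ^+ 2 * a ^+ 2 * sq_beta)%:E)%E.
Proof.
have adj : adjoint_pair ip (Ti \o Phat \o Q) (Q \o Phat \o Ti).
  by move=> x y; rewrite /= Tinv_self Phat_self Qself.
have adj' : adjoint_pair ip (Q \o Phat \o Ti) (Ti \o Phat \o Q).
  by move=> x y; rewrite /= Qself Phat_self Tinv_self.
have adjAP : adjoint_pair ip (A \o P) (P \o A) by move=> x y; rewrite /= Aself P_self.
have AP : opbound (A \o P) a.
  by move=> x /=; rewrite (le_trans (Abound _)) // ler_wpM2l // P_norm.
have h0 : (hs (Q \o Phat \o Ti) <= (8 * gam * sq_beta)%:E)%E.
  by rewrite -(hs_adj adj) hs_TinvPhatQ.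
have h1 := sq_hs_compr ipN ob adj' adjAP a0 AP h0.
have gg : Num.sqrt gam ^+ 2 = gam by rewrite sqr_sqrtr // ltW.
have -> : 8 * gam ^+ 2 * a ^+ 2 * sq_beta =
    Num.sqrt gam ^+ 2 * (a ^+ 2 * (8 * gam * sq_beta)) by rewrite gg; ring.
apply: (sq_hs_le_scale _ _ h1); first exact: sqrtr_ge0.
move=> i Di /=.
have PP : P (P (psi i)) = P (psi i) by rewrite (PJ_idem es).
rewrite E_factor (Tinv_on PP) (linZ linA) (linZ linTinv) (linZ linPhat) (linZ linQ).
by rewrite normrZ ger0_norm ?sqrtr_ge0.
Qed.

Lemma singleton_block k : k \in J -> interval_block [fset k]%fset (lam (inl k)) 0.
Proof.
move=> kJ; split=> //; last exact: ltW.
- by move=> k'; rewrite inE => /eqP ->.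
- by move=> k'; rewrite inE => /eqP ->; rewrite subrr normr0.
- by move=> l lo; rewrite add0r; exact: dist_le.
Qed.

Lemma Q_remainder_psi_le k : k \in J -> `|Q (err (psi (inl k)))| <=
  (Num.sqrt gam)^-1 * (a * `|Ti (Qhat (psi (inl k)))|)
  + gam^-1 * `|Q (Phat (E (psi (inl k))))|.
Proof.
move=> kJ; have Kcr := singleton_block kJ; have sb := shres_bounded Kcr.
have Pp := P_psi kJ; have g0 := sqrt_gap_gt0 gam0.
have gg : Num.sqrt gam ^+ 2 = gam by rewrite sqr_sqrtr // ltW.
have -> : Q (err (psi (inl k))) = dg (shres (lam (inl k))) (source (psi (inl k))).
  apply: (coord_ext ob) => i Di; rewrite (diagop_coord ipN ob) //.
  have [io|io] := pselect (off s J i); last by rewrite Q_on // shres_out // mul0r.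
  have h := remainder_sylvester Pp io.
  have Hk : H (psi (inl k)) = lam (inl k) *: psi (inl k).
    by case: es => _ -> //; exact: JD.
  rewrite Hk (linZ linremainder) ipZr in h.
  rewrite Q_off // /shres mem_set //.
  have n0 : lam i - lam (inl k) != 0.
    rewrite subr_eq0; have := gap_le kJ io; apply: contraTneq => ->.
    by rewrite subrr normr0 -ltNge.
  have -> : ip (psi i) (source (psi (inl k))) =
      (lam i - lam (inl k)) * ip (psi i) (err (psi (inl k))).
    by rewrite mulrBl h addrC addKr.
  by rewrite mulKf.
rewrite /source (linD (diagop_lin ipN ob sb)) (le_trans (ler_normD _ _)) // lerD //.
  have := shres_E_le Kcr (Qhat (psi (inl k))).
  by rewrite add0r -[X in _ / X]gg expr2 invfM mulVKf // gt_eqF.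
rewrite -dg_off_Q //; last exact: shres_out.
by rewrite (le_trans (diagop_le ipN ob _ (shres_le Kcr))) // add0r.
Qed.

Lemma hs_QremainderP : (hs (Q \o err \o P) <= (32 * a ^+ 2 * sq_beta)%:E)%E.
Proof.
have gg : Num.sqrt gam ^+ 2 = gam by rewrite sqr_sqrtr // ltW.
have ng : gam != 0 by rewrite gt_eqF.
have -> : 32 * a ^+ 2 * sq_beta = 2 * a ^+ 2 / gam * (8 * gam * sq_beta)
    + 2 / gam ^+ 2 * (8 * gam ^+ 2 * a ^+ 2 * sq_beta) by field.
apply: (sq_hs_le_comb (B := Ti \o Qhat \o P) (C := Q \o Phat \o E \o P)).
- by rewrite divr_ge0 ?(ltW gam0) // mulr_ge0 // sqr_ge0.
- by rewrite divr_ge0 // sqr_ge0.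
- move=> i Di; have [iJ|iJ] := boolP (i \in Jidx); last first.
    rewrite /= P_out // (lin0 linremainder) (lin0 linQ) normr0 expr0n /=.
    rewrite addr_ge0 // mulr_ge0 ?sqr_ge0 // divr_ge0 ?sqr_ge0 ?(ltW gam0) //.
    by rewrite mulr_ge0 // sqr_ge0.
  have /imfsetP [k /= kJ ->] := iJ.
  rewrite /= P_psi //; have h := Q_remainder_psi_le kJ.
  have h2 : `|Q (err (psi (inl k)))| ^+ 2 <= ((Num.sqrt gam)^-1 * (a * `|Ti (Qhat (psi (inl k)))|)
      + gam^-1 * `|Q (Phat (E (psi (inl k))))|) ^+ 2.
    by rewrite ler_pXn2r ?nnegrE // (le_trans _ h).
  apply: (le_trans h2).
  have -> : 2 * a ^+ 2 / gam * `|Ti (Qhat (psi (inl k)))| ^+ 2 =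
      2 * ((Num.sqrt gam)^-1 * (a * `|Ti (Qhat (psi (inl k)))|)) ^+ 2.
    by rewrite exprMn exprVn gg exprMn; ring.
  have -> : 2 / gam ^+ 2 * `|Q (Phat (E (psi (inl k))))| ^+ 2 =
      2 * (gam^-1 * `|Q (Phat (E (psi (inl k))))|) ^+ 2.
    by rewrite exprMn exprVn; ring.
  move: (_ * (a * _)) (_ * `|Q _|) => X Y.
  by have := sqr_ge0 (X - Y); nra.
- exact: hs_TinvQhatP.
- exact: hs_QPhatE.
Qed.

(** The four blocks of the remainder with respect to [P] and [Q] are orthogonal for the
    Hilbert-Schmidt inner product. *)
Lemma hs_remainder : (hs err <= ((8 * tau ^+ 2 + 64 * a ^+ 2) * sq_beta)%:E)%E.
Proof.
have split_PQ (B : V -> V) : hs B = (hs (P \o B) + hs (Q \o B))%E.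
  by apply: sq_hs_eqD => i Di; rewrite (PJ_pythagoras ipN es (B (psi i)) JD).
have adjP : adjoint_pair ip (P \o err) (err \o P).
  by move=> x y; rewrite /= P_self remainder_self.
have adjQ : adjoint_pair ip (Q \o err) (err \o Q).
  by move=> x y; rewrite /= Qself remainder_self.
have adjPQ : adjoint_pair ip (P \o err \o Q) (Q \o err \o P).
  by move=> x y; rewrite /= P_self remainder_self Qself.
have adjQP : adjoint_pair ip (Q \o Phat) (Phat \o Q).
  by move=> x y; rewrite /= Qself Phat_self.
have e1 : hs err = (hs (P \o err \o P) + hs (Q \o err \o P)
    + (hs (P \o err \o Q) + hs (Q \o err \o Q)))%E.
  rewrite (split_PQ err) (hs_adj adjP) (hs_adj adjQ).
  by rewrite (split_PQ (err \o P)) (split_PQ (err \o Q)).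
have hpp : (hs (P \o err \o P) <= (tau ^+ 2 * (4 * sq_beta))%:E)%E.
  apply: (sq_hs_le_scale (B := Qhat \o P)); [exact: tau_ge0| |exact: hs_QhatP].
  move=> i Di /=; rewrite P_remainder_P normrN -{1}QhatQhat; exact: P_Qhat_le.
have hqq : (hs (Q \o err \o Q) <= (tau ^+ 2 * (4 * sq_beta))%:E)%E.
  apply: (sq_hs_le_scale (B := Phat \o Q)); [exact: tau_ge0| |].
    by move=> i Di /=; rewrite Q_remainder_Q -{1}Phat_idem; exact: Q_Phat_le.
  by rewrite -(hs_adj adjQP) hs_QPhat.
have hqp := hs_QremainderP.
have hpq : (hs (P \o err \o Q) <= (32 * a ^+ 2 * sq_beta)%:E)%E.
  by rewrite (hs_adj adjPQ).
rewrite e1; apply: le_trans (leeD (leeD hpp hqp) (leeD hpq hqq)) _.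
by rewrite -!EFinD lee_fin le_eqVlt; apply/orP; left; apply/eqP; ring.
Qed.

Lemma hs_norm_remainder : (hs_norm ip err <=
  (Num.sqrt (8 * tau ^+ 2 + 64 * a ^+ 2) * Num.sqrt sq_beta)%:E)%E.
Proof.
rewrite (hs_normE ipN ob remainder_self).
have := hs_remainder; rewrite -lee_sqrt ?lee_fin ?mulr_ge0 ?sq_beta_ge0 //.
  move/le_trans; apply; rewrite /= sqrtrM //.
  by rewrite addr_ge0 // mulr_ge0 // sqr_ge0.
by rewrite addr_ge0 // mulr_ge0 // sqr_ge0.
Qed.

End Grouped.

End Perturbation.

(** * Sorting the eigenvalues into intervals, and numerical constants *)

Section Grouping.
Context {R : realType} {V : completeNormedModType R}.
Variables (s : eigensystem V) (J : {fset nat}).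
Hypothesis lam_bounded : bounded_symbol (eigidx s) (eigval s).
Hypothesis JD : used_block s J.
Hypothesis J0 : J != fset0.
Hypothesis gam0 : 0 < gap s J.
Local Notation lam := (eigval s).
Local Notation gam := (gap s J).

Lemma theta_max_ge k : k \in J -> lam (inl k) <= theta_max s J.
Proof.
case: lam_bounded => C lamC kJ; apply: sup_upper_bound; last by exists k.
split; first by exists (lam (inl k)); exists k.
exists C => _ [k' /= k'J <-]; exact: le_trans (ler_norm _) (lamC _ (JD k'J)).
Qed.

Lemma theta_min_le k : k \in J -> theta_min s J <= lam (inl k).
Proof.
case: lam_bounded => C lamC kJ; apply: ge_inf; last by exists k.
exists (- C) => _ [k' /= k'J <-].
by have := lamC _ (JD k'J); rewrite ler_norml => /andP[].
Qed.

(** Width of the intervals into which the eigenvalues of [J] are sorted. Being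
    below twice the gap, it leaves no room for an eigenvalue outside [J] between
    two members of the same interval. *)
Definition width : R := pi * gam / 2.

Lemma width_gt0 : 0 < width.
Proof. by rewrite /width divr_gt0 // mulr_gt0 // pi_gt0. Qed.

Lemma width_lt : width < 2 * gam.
Proof.
have := pihalf_lt2 R; rewrite /width mulrAC => p2.
by rewrite ltr_pM2r.
Qed.

Definition level (x : R) : nat := Num.truncn ((theta_max s J - x) / width).
Definition level_label k : nat := level (lam (inl k)).

Lemma same_level_close k k' : k \in J -> k' \in J ->
  level_label k = level_label k' -> lam (inl k) - lam (inl k') < width.
Proof.
move=> kJ k'J; rewrite /level_label /level => e; have w0 := width_gt0.
have h i : i \in J -> 0 <= (theta_max s J - lam (inl i)) / width.
  by move=> iJ; rewrite divr_ge0 ?(ltW w0) // subr_ge0 theta_max_ge.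
have /andP[h1 _] := truncn_itv (h _ kJ); have /andP[_ h2] := truncn_itv (h _ k'J).
rewrite e -natr1 in h1 h2 *.
have : (theta_max s J - lam (inl k')) / width - (theta_max s J - lam (inl k)) / width < 1.
  by lra.
by rewrite -mulrBl ltr_pdivrMr // mul1r; lra.
Qed.

Lemma seq_argmax (t : seq nat) (f : nat -> R) : t != [::] ->
  exists2 k, k \in t & forall k', k' \in t -> f k' <= f k.
Proof.
elim: t => // x t IH _; have [->|t0] := eqVneq t [::].
  by exists x; rewrite ?inE // => k'; rewrite inE => /eqP ->.
have [k kt kmax] := IH t0; have [fx|fx] := leP (f x) (f k).
  exists k; first by rewrite inE kt orbT.
  by move=> k'; rewrite inE => /predU1P [->//|]; exact: kmax.
exists x; first by rewrite inE eqxx.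
move=> k'; rewrite inE => /predU1P [->//|/kmax h]; exact: le_trans h (ltW fx).
Qed.

(** The interval is the hull of the eigenvalues in the bucket, not the cell of the
    grid: its end points are then eigenvalues of [J], and [dist] bounds the
    distance to them. *)
Lemma level_grouping b : b \in labels J level_label ->
  exists c r, interval_block s J (bucket J level_label b) c r.
Proof.
move=> /imfsetP [k0 /= k0J bk0].
set K := bucket J level_label b.
have k0K : k0 \in K by rewrite !inE /= k0J bk0 eqxx.
have K0 : (K : seq nat) != [::].
  by apply: contraTneq k0K => K0; rewrite -[_ \in _]/(k0 \in enum_fset K) K0.
have [kh khK hmax] := seq_argmax (fun k => lam (inl k)) K0.
have [kl klK lmin] := seq_argmax (fun k => - lam (inl k)) K0.
have KJ : {subset K <= J} by exact: bucket_sub.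
have Kb k : k \in K -> level_label k = b by rewrite !inE /= => /andP[_ /eqP].
have hl : lam (inl kh) - lam (inl kl) < width.
  by apply: same_level_close; rewrite ?KJ // !Kb.
have w2 := width_lt.
exists ((lam (inl kh) + lam (inl kl)) / 2), ((lam (inl kh) - lam (inl kl)) / 2).
have lh := hmax _ klK.
split=> //.
- move=> k kK; have h1 := hmax _ kK; have := lmin _ kK; rewrite lerN2 => h2.
  by rewrite ler_norml; apply/andP; split; lra.
- move=> l lo; have g1 := gap_le (KJ _ khK) lo; have g2 := gap_le (KJ _ klK) lo.
  have d1 := dist_le s l (KJ _ khK); have d2 := dist_le s l (KJ _ klK).
  rewrite /dist in d1 d2 *.
  have [l1|l1] := leP (lam (inl kh)) (lam l).
    rewrite ger0_norm in d1; last by lra.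
    by rewrite ger0_norm; lra.
  have [l2|l2] := leP (lam l) (lam (inl kl)).
    rewrite ler0_norm in d2; last by lra.
    by rewrite ler0_norm; lra.
  rewrite ger0_norm in g1; last by lra.
  by rewrite ler0_norm in g2; lra.
- by lra.
- by lra.
Qed.

Lemma labels_le_values : (#|` labels J level_label| <= nb_values s J)%N.
Proof.
have -> : labels J level_label = [fset level x | x in [fset lam (inl k) | k in J]]%fset.
  apply/fsetP => b; apply/imfsetP/imfsetP => [[k /= kJ ->]|[x /= /imfsetP [k /= kJ ->] ->]].
    by exists (lam (inl k)) => //; apply/imfsetP; exists k.
  by exists k.
exact: leq_imfset_card.
Qed.

Lemma labels_le_length : (#|` labels J level_label|)%:R <=
  1 + (2 * theta_max s J - 2 * theta_min s J) / (pi * gam).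
Proof.
have w0 := width_gt0.
case/fset0Pn: J0 => k0 k0J.
have mm : 0 <= theta_max s J - theta_min s J.
  by rewrite subr_ge0 (le_trans (theta_min_le k0J)) // theta_max_ge.
pose x := (theta_max s J - theta_min s J) / width.
have x0 : 0 <= x by rewrite divr_ge0 // ltW.
have -> : 1 + (2 * theta_max s J - 2 * theta_min s J) / (pi * gam) = 1 + x.
  rewrite /x /width; move: (gam0) (pi_gt0 R); move: gam (pi : R) => g p g0 p0.
  by field; rewrite !gt_eqF.
apply: (@le_trans _ _ ((Num.truncn x).+1)%:R); last first.
  by rewrite -natr1 addrC lerD2l truncn_le.
rewrite ler_nat -(size_iota 0 (Num.truncn x).+1); apply: uniq_leq_size.
  exact: fset_uniq.
move=> b /imfsetP [k kJ ->]; rewrite mem_iota /= add0n ltnS.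
apply: le_truncn; rewrite ler_pM2r ?invr_gt0 // lerD2l lerN2.
exact: theta_min_le.
Qed.

Lemma labels_gt0 : 1 <= (#|` labels J level_label|)%:R :> R.
Proof.
case/fset0Pn: J0 => k0 k0J; rewrite ler1n cardfs_gt0; apply/fset0Pn.
by exists (level_label k0); apply/imfsetP; exists k0.
Qed.

End Grouping.

Section Constants.
Context {R : realType}.
Implicit Types a m : R.

(** With [u = sqrt m * a] the claim is [1 + u <= 8 u^2 + 32 a^2].  At
    [u = 43/100] the term [8 u^2] is enough; at [a = 7/40] the term [32 a^2]
    nearly pays for the constant. *)
Lemma crude_constant a m : 0 <= a -> 1 <= m ->
  (7 / 40 <= a) || (43 / 100 <= Num.sqrt m * a) ->
  1 + Num.sqrt m * a <= (8 * m + 32) * a ^+ 2.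
Proof.
move=> a0 m1.
have s1 : 1 <= Num.sqrt m by rewrite -sqrtr1 ler_wsqrtr.
have -> : (8 * m + 32) * a ^+ 2 = 8 * (Num.sqrt m * a) ^+ 2 + 32 * a ^+ 2.
  by rewrite exprMn sqr_sqrtr ?(le_trans ler01) //; ring.
have sa : a <= Num.sqrt m * a by rewrite ler_peMl.
by move: sa; move: (Num.sqrt m * a) => t ta /orP[h|h]; nra.
Qed.

(** Here [u = sqrt m * a], and [t * u], [w * u] are the bounds on [Q Phat] and
    on its weighted version. *)
Lemma fine_constant a m (u t w : R) : 0 <= a -> a <= 7 / 40 ->
  0 <= u -> u <= 43 / 100 -> u ^+ 2 = m * a ^+ 2 ->
  t = 2 / (2 - 5 * a + a ^+ 2) -> w = (3 - a) / (2 - 5 * a + a ^+ 2) ->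
  u ^+ 2 * (t ^+ 2 + w + t + (t ^+ 2 + t * w) * u) <= (8 * m + 32) * a ^+ 2.
Proof.
move=> a0 a1 u0 u1 um tE wE.
have a2 := sqr_ge0 a.
have d0 : 0 < 2 - 5 * a + a ^+ 2 by lra.
have t0 : 0 <= t by rewrite tE divr_ge0 // ltW.
have w0 : 0 <= w by rewrite wE divr_ge0 ?(ltW d0) //; lra.
have tot T0 W0 : t <= T0 -> w <= W0 ->
    t ^+ 2 + w + t + (t ^+ 2 + t * w) * u <=
    T0 ^+ 2 + W0 + T0 + (T0 ^+ 2 + T0 * W0) * (43 / 100).
  move=> tT wW.
  have tt : t ^+ 2 <= T0 ^+ 2 by rewrite ler_pXn2r ?nnegrE // (le_trans t0).
  have tw : t * w <= T0 * W0 by rewrite ler_pM.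
  have : (t ^+ 2 + t * w) * u <= (T0 ^+ 2 + T0 * W0) * (43 / 100).
    by apply: ler_pM => //; [rewrite addr_ge0 ?sqr_ge0 ?mulr_ge0|exact: lerD].
  by lra.
have -> : (8 * m + 32) * a ^+ 2 = 8 * u ^+ 2 + 32 * a ^+ 2 by rewrite um; ring.
(* For [a <= 3/25] the bracket is below 8.  Otherwise [u <= 43/100] implies
   [u ^+ 2 <= 13 * a ^+ 2], and its excess over 8 is paid by [32 * a ^+ 2]. *)
have [small|large] := leP a (3 / 25).
  have tT : t <= 1415 / 1000 by rewrite tE ler_pdivrMr //; nra.
  have wW : w <= 204 / 100 by rewrite wE ler_pdivrMr //; nra.
  have h := ler_wpM2l (sqr_ge0 u) (tot _ _ tT wW).
  apply: (le_trans h); have := sqr_ge0 u; move: (u ^+ 2) => uu uu0; nra.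
have tT : t <= 1731 / 1000 by rewrite tE ler_pdivrMr //; nra.
have wW : w <= 245 / 100 by rewrite wE ler_pdivrMr //; nra.
have h := ler_wpM2l (sqr_ge0 u) (tot _ _ tT wW).
apply: (le_trans h).
have ul : u ^+ 2 <= (43 / 100) ^+ 2 by rewrite ler_pXn2r ?nnegrE.
have al : (3 / 25) ^+ 2 <= a ^+ 2 by rewrite ler_pXn2r ?nnegrE // ltW.
by move: ul al (sqr_ge0 u); move: (u ^+ 2) (a ^+ 2) => uu aa; lra.
Qed.

Lemma hs_constant a m d : 0 <= a -> a <= 1 / 4 -> 0 <= m -> m <= d ->
  Num.sqrt (8 * (Num.sqrt m * (2 * a / (2 - 5 * a + a ^+ 2))) ^+ 2 + 64 * a ^+ 2)
  <= (112 * Num.sqrt d / 9 + 16) * a.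
Proof.
move=> a0 a1 m0 md.
have d0 : 13 / 16 <= 2 - 5 * a + a ^+ 2 by nra.
pose t := 2 / (2 - 5 * a + a ^+ 2).
have t0 : 0 <= t by rewrite divr_ge0 //; lra.
have tT : t <= 5 / 2 by rewrite ler_pdivrMr; lra.
have -> : 8 * (Num.sqrt m * (2 * a / (2 - 5 * a + a ^+ 2))) ^+ 2 + 64 * a ^+ 2 =
    (8 * m * t ^+ 2 + 64) * a ^+ 2.
  by rewrite -{2}(sqr_sqrtr m0) /t; ring.
clearbody t.
have sd : Num.sqrt d ^+ 2 = d by rewrite sqr_sqrtr // (le_trans m0).
have sd0 := sqrtr_ge0 d.
have rhs0 : 0 <= 112 * Num.sqrt d / 9 + 16 by lra.
rewrite -[leRHS]ger0_norm ?mulr_ge0 // -sqrtr_sqr ler_wsqrtr // exprMn ler_wpM2r ?sqr_ge0 //.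
have tt : t ^+ 2 <= (5 / 2) ^+ 2 by rewrite ler_pXn2r ?nnegrE //; lra.
have h : m * t ^+ 2 <= Num.sqrt d ^+ 2 * (5 / 2) ^+ 2 by rewrite sd ler_pM // sqr_ge0.
rewrite -mulrA; move: h sd0; move: (m * t ^+ 2) (Num.sqrt d) => X q h q0.
by have := sqr_ge0 q; nra.
Qed.

End Constants.

Section OpNorm.
Context {R : realType} {V : completeNormedModType R}.

Lemma op_norm_le (B : V -> V) (C : R) : 0 <= C -> opbound B C ->
  (op_norm B <= C%:E)%E.
Proof.
move=> C0 BC; apply: ge_ereal_sup => _ [x /= x1 <-]; rewrite lee_fin.
by rewrite (le_trans (BC x)) // ler_piMr.
Qed.

Lemma op_norm_ge0 (B : V -> V) : (0 <= op_norm B)%E.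
Proof.
apply: (@le_trans _ _ (`|B 0|)%:E); first by rewrite lee_fin.
by apply: ereal_sup_ubound; exists 0 => //=; rewrite normr0.
Qed.

Lemma opbound_op_norm (B : V -> V) (a : R) : linear B ->
  op_norm B = a%:E -> opbound B a.
Proof.
move=> lB Ba x; have [->|x0] := eqVneq x 0.
  by rewrite (lin0 lB) normr0 mulr0.
have nx : 0 < `|x| by rewrite normr_gt0.
have : (`|B (`|x|^-1 *: x)|%:E <= a%:E)%E.
  rewrite -Ba; apply: ereal_sup_ubound; exists (`|x|^-1 *: x) => //=.
  by rewrite normrZ normfV normr_id mulVf ?gt_eqF.
rewrite lee_fin (linZ lB) normrZ normfV normr_id.
by rewrite mulrC ler_pdivrMr.
Qed.

End OpNorm.

(** * The perturbation bounds *)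

Unset Implicit Arguments.

Theorem theorem3p4 (R : realType) (V : completeNormedModType R)
    (ip : {dot V for @idfun R})
    (V_hilbert : norm_induced_by ip)
    (V_separable : separable_space V)
    (H Hhat : {linear V -> V})
    (H_compact : compact_operator H)
    (H_selfadj : self_adjoint ip H)
    (H_nonneg : nonneg_eigenvalues H)
    (Hhat_compact : compact_operator Hhat)
    (Hhat_selfadj : self_adjoint ip Hhat)
    (Hhat_nonneg : nonneg_eigenvalues Hhat)
    (s shat : eigensystem V)
    (s_eigen : is_eigensystem ip H s)
    (shat_eigen : is_eigensystem ip Hhat shat)
    (J : {fset nat})
    (J_nonempty : J != fset0)
    (J_idx : forall k, k \in J -> eigidx s (inl k) /\ eigidx shat (inl k))
    (J_gap : 0 < gap s J) :
  let E : V -> V := Hhat \- H in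
  let err : V -> V := PJ ip shat J \- PJ ip s J \- SJ ip s J E in
  let D : R := (nb_values s J)%:R in
  let alpha := alphaJ ip s J E in
  let beta := betaJ ip s J E in
  (op_norm err <=
    (8 * Num.min D (1 + (2 * theta_max s J - 2 * theta_min s J)
                          / (pi * gap s J)) + 32)%:E * alpha ^+ 2)%E
  /\
  ((alpha <= (1 / 4)%:E)%E ->
   (hs_norm ip err <= (112 * Num.sqrt D / 9 + 16)%:E * alpha * beta)%E).
Proof.
move=> E err D alpha beta.
have linH : linear H by move=> c x y; rewrite linearP.
have linHhat : linear Hhat by move=> c x y; rewrite linearP.
have JD : used_block s J by move=> k /J_idx [].
have JDhat : used_block shat J by move=> k /J_idx [].
have lamb := eigval_bounded s_eigen.
have grouping := level_grouping lamb JD J_gap.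
have m1 := labels_gt0 s J_nonempty.
have mD : (#|` labels J (level_label s J)|)%:R <= D by rewrite ler_nat labels_le_values.
have mL := labels_le_length lamb JD J_nonempty J_gap.
set m : R := (#|` labels J (level_label s J)|)%:R in m1 mD mL.
set K := Num.min D _.
have mK : m <= K by rewrite /K le_min mD mL.
have K0 : 0 < 8 * K + 32 by lra.
have alpha0 : (0 <= alpha)%E by exact: op_norm_ge0.
case alphaE : alpha alpha0 => [a| |] // a0; last first.
  split=> //; rewrite expe2 mulyy; apply: le_trans (leey _) _.
  by rewrite mulry gtr0_sg // mul1e.
rewrite lee_fin in a0.
have Ab := opbound_op_norm
  (linA V_hilbert linH linHhat H_selfadj s_eigen J_nonempty JD J_gap) alphaE.
pose crude := remainder_norm_crude V_hilbert linH linHhat H_selfadj Hhat_selfadj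
  s_eigen shat_eigen J_nonempty JD JDhat J_gap a0 Ab grouping.
split.
  rewrite -EFin_expe -EFinM.
  apply: (@le_trans _ _ ((8 * m + 32) * a ^+ 2)%:E); last first.
    by rewrite lee_fin ler_wpM2r ?sqr_ge0 // lerD2r ler_pM2l.
  have c0 : 0 <= (8 * m + 32) * a ^+ 2 by rewrite mulr_ge0 ?sqr_ge0 //; lra.
  apply: op_norm_le => // x.
  have [big|] := boolP ((7 / 40 <= a) || (43 / 100 <= Num.sqrt m * a)).
    apply: le_trans (crude x) _; rewrite ler_wpM2r //; exact: crude_constant.
  rewrite negb_or -!ltNge => /andP[a1 u1].
  have a4 : a <= 1 / 4 by lra.
  apply: le_trans (remainder_norm V_hilbert linH linHhat H_selfadj Hhat_selfadj
    s_eigen shat_eigen J_nonempty JD JDhat J_gap a0 Ab grouping a4 x) _.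
  rewrite ler_wpM2r // /defect /weighted_defect -/m.
  have um : (Num.sqrt m * a) ^+ 2 = m * a ^+ 2.
    by rewrite exprMn sqr_sqrtr // (le_trans _ m1).
  have u0 : 0 <= Num.sqrt m * a by rewrite mulr_ge0 ?sqrtr_ge0.
  apply: le_trans (fine_constant a0 (ltW a1) u0 (ltW u1) um erefl erefl).
  by rewrite le_eqVlt; apply/orP; left; apply/eqP; ring.
rewrite lee_fin => a4.
have -> : beta = (Num.sqrt (sq_beta ip H Hhat s J))%:E.
  exact: (betaE V_hilbert linH linHhat H_selfadj Hhat_selfadj s_eigen
    J_nonempty JD J_gap).
apply: le_trans (hs_norm_remainder V_hilbert linH linHhat H_selfadj Hhat_selfadj
  s_eigen shat_eigen J_nonempty JD JDhat J_gap a0 Ab grouping a4) _.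
rewrite -!EFinM lee_fin ler_wpM2r ?sqrtr_ge0 //.
by apply: hs_constant => //; exact: le_trans ler01 m1.
Qed.
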